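(* Let $k$ be a field, $A$ a $k$-algebra, $\mathcal C$ an $A$-coring, and $M$ a Galois right $\mathcal C$-comodule with endomorphism ring $S=\mathrm{End}^{-\mathcal C}(M)$. View $S\otimes_k M$ as a right $\mathcal C$-comodule via $S\otimes_k\varrho^M$ and $M^*\otimes_k S$ as a left $\mathcal C$-comodule via ${}^{M^*}\!\varrho\otimes_k S$. (1) If $M$ is faithfully flat as a left $S$-module and there exists a right $S$-module left $\mathcal C$-comodule section of the action $M^*\otimes_k S\to M^*$, then, for every left $\mathcal C$-comodule $V$ that is finitely generated projective as a left $A$-module, $\mathrm{Hom}^{\mathcal C-}(V,M^* )$ is a finitely generated projective right $S$-module. (2) If $M^*$ is faithfully flat as a right $S$-module and there exists a left $S$-module right $\mathcal C$-comodule section of the action $S\otimes_k M\to M$, then, for every right $\mathcal C$-comodule $W$ that is finitely generated projective as a right $A$-module, $\mathrm{Hom}^{-\mathcal C}(W,M)$ is a finitely generated projective left $S$-module.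
   Context: Algebras are associative and unital. An $A$-coring $\mathcal C$ is an $(A,A)$-bimodule with coassociative coproduct $\Delta_{\mathcal C}:\mathcal C\to\mathcal C\otimes_A\mathcal C$ and counit $\varepsilon_{\mathcal C}:\mathcal C\to A$ (bimodule maps). Right coactions are written $\varrho^M(m)=\sum m_{(0)}\otimes m_{(1)}\in M\otimes_A\mathcal C$. $\mathrm{Hom}^{-\mathcal C}$ (resp. $\mathrm{Hom}^{\mathcal C-}$) denotes colinear maps of right (resp. left) $\mathcal C$-comodules. $S=\mathrm{End}^{-\mathcal C}(M)$ is a ring under composition; $M$ is a left $S$-module, $\mathrm{Hom}^{-\mathcal C}(M,N)$ is a right $S$-module ($fs=f\circ s$) and $\mathrm{Hom}^{-\mathcal C}(W,M)$ is a left $S$-module ($sf=s\circ f$). A right $\mathcal C$-comodule $M$ is Galois if it is finitely generated and projective as a right $A$-module and $\mathrm{Hom}^{-\mathcal C}(M,\mathcal C)\otimes_S M\to\mathcal C$, $f\otimes m\mapsto f(m)$, is an isomorphism of right $\mathcal C$-comodules ($\mathcal C$ a comodule via $\Delta_{\mathcal C}$). $M^*=\mathrm{Hom}_{-A}(M,A)$ is a left $\mathcal C$-comodule with coaction ${}^{M^*}\!\varrho(\xi)=\sum_i\xi(e^i_{(0)})e^i_{(1)}\otimes\xi^i$, where $\{e^i\in M,\xi^i\in M^*\}$ is a finite dual basis of $M_A$, and a right $S$-module via $\xi s=\xi\circ s$ (the $S$-action is by left $\mathcal C$-colinear maps). $\mathrm{Hom}^{\mathcal C-}(V,M^* )$ is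 a right $S$-module via $(fs)(v)=f(v)s$. *)

(* Defs.v *)
From HB Require Import structures.
From mathcomp Require Import all_boot all_algebra.
From mathcomp Require Import boolp functions.

Set Implicit Arguments.
Unset Strict Implicit.
Unset Printing Implicit Defensive.

Import GRing.Theory.
Local Open Scope ring_scope.
Local Open Scope quotient_scope.

#[local] Obligation Tactic := idtac.

(* A k-algebra as a ring with a central ring homomorphism from k.  The
   library's [algType] cannot be used: it excludes the zero algebra, whereas
   End(M) is zero when M is. *)
Record kalg (k : fieldType) := KAlg {
  kalg_ring :> pzRingType;
  kalg_unit : {rmorphism k -> kalg_ring};
  kalg_central : forall (c : k) (a : kalg_ring),
    kalg_unit c * a = a * kalg_unit c
}.
Arguments kalg_unit {k} A : rename.

Definition ground (k : fieldType) : kalg k :=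
  @KAlg k k idfun (fun c a => mulrC c a).

Fact in_alg_central (k : fieldType) (A : algType k) (c : k) (a : A) :
  in_alg A c * a = a * in_alg A c.
Proof. by rewrite /= mulr_algl mulr_algr. Qed.

Definition kalg_of_algType (k : fieldType) (A : algType k) : kalg k :=
  @KAlg k A (in_alg A) (@in_alg_central k A).

Lemma addm0 (U V : zmodType) (f : U -> V) : {morph f : x y / x + y} -> f 0 = 0.
Proof. by move=> fD; apply: (addIr (f 0)); rewrite -fD !add0r. Qed.

Lemma addm_sum (U V : zmodType) (f : U -> V) I (r : seq I) (F : I -> U) :
  {morph f : x y / x + y} ->
  f (\sum_(i <- r) F i) = \sum_(i <- r) f (F i).
Proof. by move=> fD; rewrite (big_morph f fD (addm0 fD)). Qed.

Lemma addm_opp (U V : zmodType) (f : U -> V) :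
  {morph f : x y / x + y} -> {morph f : x / - x}.
Proof.
by move=> fD x; apply: (addrI (f x)); rewrite -fD !subrr (addm0 fD).
Qed.

(* X (x)_R Y as an abelian group: formal sums of pairs modulo the congruence
   generated by the biadditivity and balancing relations.  It depends only on
   the groups X, Y and on the two inner actions ra, la of R; in particular it
   is unaffected by the further actions that X and Y may carry. *)
Section TensorGroup.
Variables (X Y : zmodType) (R : Type) (ra : X -> R -> X) (la : R -> Y -> Y).

Inductive tens_rel : seq (X * Y) -> seq (X * Y) -> Prop :=
| TensRefl s : tens_rel s s
| TensSym s t : tens_rel s t -> tens_rel t s
| TensTrans s t u : tens_rel s t -> tens_rel t u -> tens_rel s u
| TensCat s s' t t' :
    tens_rel s s' -> tens_rel t t' -> tens_rel (s ++ t) (s' ++ t')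
| TensComm s t : tens_rel (s ++ t) (t ++ s)
| Tens0l y : tens_rel [:: (0, y)] [::]
| Tens0r x : tens_rel [:: (x, 0)] [::]
| TensDl x x' y : tens_rel [:: (x + x', y)] [:: (x, y); (x', y)]
| TensDr x y y' : tens_rel [:: (x, y + y')] [:: (x, y); (x, y')]
| TensBal x r y : tens_rel [:: (ra x r, y)] [:: (x, la r y)].

Definition tens_relb (s t : seq (X * Y)) : bool := `[< tens_rel s t >].

Fact tens_relb_equiv : equiv_class_of tens_relb.
Proof.
split=> [s|s t|t s u].
- exact/asboolP/TensRefl.
- by apply/asboolP/asboolP => /TensSym.
- by move=> /asboolP st /asboolP tu; apply/asboolP; exact: TensTrans st tu.
Qed.

Canonical tens_equiv := EquivRelPack tens_relb_equiv.

Definition tens := {eq_quot tens_equiv}.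
HB.instance Definition _ := Choice.on tens.
HB.instance Definition _ := EqQuotient.on tens.

Definition tens_of (s : seq (X * Y)) : tens := \pi_tens s.

Lemma tens_ofP s t : tens_rel s t -> tens_of s = tens_of t.
Proof. by move=> st; apply/eqmodP; apply/asboolP. Qed.

Lemma tens_of_inj s t : tens_of s = tens_of t -> tens_rel s t.
Proof. by move=> /eqmodP /asboolP. Qed.

Lemma tens_ofK (t : tens) : tens_of (repr t) = t.
Proof. exact: reprK. Qed.

Definition opps (s : seq (X * Y)) := [seq (- p.1, p.2) | p <- s].

Definition tens0 : tens := tens_of [::].
Definition tensD (s t : tens) : tens := tens_of (repr s ++ repr t).
Definition tensN (s : tens) : tens := tens_of (opps (repr s)).

Lemma tensDE s t : tensD (tens_of s) (tens_of t) = tens_of (s ++ t).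
Proof. by apply: tens_ofP; apply: TensCat; apply: tens_of_inj; rewrite tens_ofK. Qed.

Fact tensA : associative tensD.
Proof.
move=> s t u; rewrite -[s]tens_ofK -[t]tens_ofK -[u]tens_ofK.
by rewrite !tensDE catA.
Qed.

Fact tensC : commutative tensD.
Proof. by move=> s t; apply: tens_ofP; exact: TensComm. Qed.

Fact tens0D : left_id tens0 tensD.
Proof. by move=> s; rewrite -[s]tens_ofK tensDE. Qed.

Fact tensND : left_inverse tens0 tensN tensD.
Proof.
move=> s; rewrite -[X in tensD _ X]tens_ofK tensDE.
elim: (repr s) => //= -[x y] r IH.
rewrite -cat1s -tensDE -[(x, y) :: r]cat1s -tensDE -tensDE.
rewrite [tensD (tens_of [:: (x, y)]) _]tensC !tensA -[X in tensD X _]tensA.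
rewrite [tensD (tens_of (opps r)) _]tensDE IH.
rewrite [tensD _ tens0]tensC tens0D tensDE /=.
rewrite -(tens_ofP (TensDl (- x) x y)) addNr.
exact: tens_ofP (Tens0l y).
Qed.

HB.instance Definition _ := GRing.isZmodule.Build tens tensA tensC tens0D tensND.

Definition tens_pure (x : X) (y : Y) : tens := tens_of [:: (x, y)].

Definition balanced (G : zmodType) (f : X -> Y -> G) :=
  [/\ forall x x' y, f (x + x') y = f x y + f x' y,
      forall x y y', f x (y + y') = f x y + f x y'
    & forall x r y, f (ra x r) y = f x (la r y)].

(* The homomorphism induced by a balanced map f; see [tens_liftE].  The value
   for a map that is not balanced is irrelevant. *)
Definition tens_lift (G : zmodType) (f : X -> Y -> G) (t : tens) : G :=
  \sum_(p <- repr t) f p.1 p.2.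

Lemma tens_pure_balanced : balanced tens_pure.
Proof.
split=> [x x' y|x y y'|x r y].
- by rewrite [RHS]tensDE; exact: tens_ofP (TensDl x x' y).
- by rewrite [RHS]tensDE; exact: tens_ofP (TensDr x y y').
- exact: tens_ofP (TensBal x r y).
Qed.

Lemma tens_of_sum s : tens_of s = \sum_(p <- s) tens_pure p.1 p.2.
Proof.
elim: s => [|[x y] s IH]; first by rewrite big_nil.
by rewrite big_cons -IH -cat1s -tensDE.
Qed.

Lemma tens_lift_pure t : tens_lift tens_pure t = t.
Proof. by rewrite /tens_lift -tens_of_sum tens_ofK. Qed.

Lemma tens_lift_comp (G H : zmodType) (h : G -> H) (f : X -> Y -> G) t :
  {morph h : x y / x + y} ->
  h (tens_lift f t) = tens_lift (fun x y => h (f x y)) t.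
Proof. by move=> hD; rewrite /tens_lift addm_sum. Qed.

Section Lift.
Variables (G : zmodType) (f : X -> Y -> G).
Hypothesis fb : balanced f.

Let f0l y : f 0 y = 0.
Proof. by apply: (@addm0 _ _ (f^~ y)) => x x'; case: fb. Qed.

Let f0r x : f x 0 = 0.
Proof. by apply: addm0 => y y'; case: fb. Qed.

Lemma tens_rel_sum s t : tens_rel s t ->
  \sum_(p <- s) f p.1 p.2 = \sum_(p <- t) f p.1 p.2.
Proof.
have [fDl fDr fB] := fb.
elim=> {s t} [s //|s t _ -> //|s t u _ -> _ -> //|s s' t t' _ e _ e'|s t|y|x|x x' y|x y y'|x r y].
- by rewrite !big_cat /= e e'.
- by rewrite !big_cat /= addrC.
- by rewrite big_seq1 big_nil /= f0l.
- by rewrite big_seq1 big_nil /= f0r.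
- by rewrite big_seq1 big_cons big_seq1 /= fDl.
- by rewrite big_seq1 big_cons big_seq1 /= fDr.
- by rewrite !big_seq1 /= fB.
Qed.

Lemma tens_lift_of s : tens_lift f (tens_of s) = \sum_(p <- s) f p.1 p.2.
Proof. by apply: tens_rel_sum; apply: tens_of_inj; rewrite tens_ofK. Qed.

Lemma tens_liftE x y : tens_lift f (tens_pure x y) = f x y.
Proof. by rewrite tens_lift_of big_seq1. Qed.

Lemma tens_liftD : {morph tens_lift f : s t / s + t}.
Proof.
move=> s t; rewrite -[s]tens_ofK -[t]tens_ofK.
by rewrite [tens_of _ + _]tensDE !tens_lift_of big_cat.
Qed.

End Lift.
End TensorGroup.

(* The ground field acts in the same way on both sides.  Consequently a right
   B-module is the same thing as a (k, B)-bimodule, and a left A-module the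
   same thing as an (A, k)-bimodule: the action of k is determined by the
   action of B, respectively A. *)
Record bimod (k : fieldType) (A B : kalg k) := Bimod {
  bcar :> zmodType;
  lact : A -> bcar -> bcar;
  ract : bcar -> B -> bcar;
  lactDr : forall a, {morph lact a : v w / v + w};
  lactDl : forall v, {morph lact^~ v : a b / a + b};
  lact1 : forall v, lact 1 v = v;
  lactM : forall a b v, lact (a * b) v = lact a (lact b v);
  ractDl : forall b, {morph ract^~ b : v w / v + w};
  ractDr : forall v, {morph ract v : a b / a + b};
  ract1 : forall v, ract v 1 = v;
  ractM : forall a b v, ract v (a * b) = ract (ract v a) b;
  lractA : forall a v b, ract (lact a v) b = lact a (ract v b);
  lractZ : forall (c : k) v, lact (kalg_unit A c) v = ract v (kalg_unit B c)
}.

Notation "a *> v" := (lact a v) (at level 40, left associativity).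
Notation "v <* b" := (ract v b) (at level 40, left associativity).

Section LinearMaps.
Variable k : fieldType.
Implicit Types A B : kalg k.

Definition llin A B B' (X : bimod A B) (Y : bimod A B') (f : X -> Y) :=
  {morph f : x y / x + y} /\ forall a x, f (a *> x) = a *> f x.

Definition rlin A A' B (X : bimod A B) (Y : bimod A' B) (f : X -> Y) :=
  {morph f : x y / x + y} /\ forall x b, f (x <* b) = f x <* b.

Definition bilin A B (X Y : bimod A B) (f : X -> Y) := llin f /\ rlin f.

Lemma llin_id A B (X : bimod A B) : llin (@id X). Proof. by []. Qed.
Lemma rlin_id A B (X : bimod A B) : rlin (@id X). Proof. by []. Qed.

Lemma ract_llin A B (X : bimod A B) b : llin (fun x : X => x <* b).
Proof. by split=> [|a x]; [exact: ractDl | exact: lractA]. Qed.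

Lemma lact_rlin A B (X : bimod A B) a : rlin (fun x : X => a *> x).
Proof. by split=> [|x b]; [exact: lactDr | rewrite lractA]. Qed.

Lemma lact0 A B (X : bimod A B) a : a *> (0 : X) = 0.
Proof. exact: addm0 (lactDr _). Qed.

Lemma ract0 A B (X : bimod A B) b : (0 : X) <* b = 0.
Proof. exact: (addm0 (ractDl b)). Qed.

Lemma lact_sumr A B (X : bimod A B) a I (r : seq I) (F : I -> X) :
  a *> (\sum_(i <- r) F i) = \sum_(i <- r) a *> F i.
Proof. exact: addm_sum (lactDr _). Qed.

Lemma ract_suml A B (X : bimod A B) b I (r : seq I) (F : I -> X) :
  (\sum_(i <- r) F i) <* b = \sum_(i <- r) F i <* b.
Proof. exact: (addm_sum _ _ (ractDl b)). Qed.

Lemma lact_suml A B (X : bimod A B) (x : X) I (r : seq I) (F : I -> A) :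
  (\sum_(i <- r) F i) *> x = \sum_(i <- r) F i *> x.
Proof. exact: (addm_sum _ _ (lactDl x)). Qed.

Lemma ract_sumr A B (X : bimod A B) (x : X) I (r : seq I) (F : I -> B) :
  x <* (\sum_(i <- r) F i) = \sum_(i <- r) x <* F i.
Proof. exact: (addm_sum _ _ (ractDr x)). Qed.

End LinearMaps.

Section BimoduleConstructions.
Variable k : fieldType.
Implicit Types A B D : kalg k.

Program Definition breg A : bimod A A :=
  @Bimod k A A A (fun a x => a * x) (fun x a => x * a) _ _ _ _ _ _ _ _ _ _.
Next Obligation. by move=> A a x y /=; rewrite mulrDr. Qed.
Next Obligation. by move=> A x a b /=; rewrite mulrDl. Qed.
Next Obligation. by move=> A x /=; rewrite mul1r. Qed.
Next Obligation. by move=> A a b x /=; rewrite mulrA. Qed.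
Next Obligation. by move=> A a x y /=; rewrite mulrDl. Qed.
Next Obligation. by move=> A x a b /=; rewrite mulrDr. Qed.
Next Obligation. by move=> A x /=; rewrite mulr1. Qed.
Next Obligation. by move=> A a b x /=; rewrite mulrA. Qed.
Next Obligation. by move=> A a x b /=; rewrite mulrA. Qed.
Next Obligation. by move=> A c x /=; rewrite kalg_central. Qed.

Program Definition rightmod A B (X : bimod A B) : bimod (ground k) B :=
  @Bimod k (ground k) B X (fun c x => kalg_unit A c *> x)
    (fun x b => x <* b) _ _ _ _ _ _ _ _ _ _.
Next Obligation. by move=> A B X c x y /=; rewrite lactDr. Qed.
Next Obligation. by move=> A B X x c d /=; rewrite rmorphD lactDl. Qed.
Next Obligation. by move=> A B X x /=; rewrite rmorph1 lact1. Qed.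
Next Obligation. by move=> A B X c d x /=; rewrite rmorphM lactM. Qed.
Next Obligation. by move=> A B X b x y /=; rewrite ractDl. Qed.
Next Obligation. by move=> A B X x a b /=; rewrite ractDr. Qed.
Next Obligation. by move=> A B X x /=; rewrite ract1. Qed.
Next Obligation. by move=> A B X a b x /=; rewrite ractM. Qed.
Next Obligation. by move=> A B X c x b /=; rewrite lractA. Qed.
Next Obligation. by move=> A B X c x /=; rewrite lractZ. Qed.

Program Definition leftmod A B (X : bimod A B) : bimod A (ground k) :=
  @Bimod k A (ground k) X (fun a x => a *> x)
    (fun x c => x <* kalg_unit B c) _ _ _ _ _ _ _ _ _ _.
Next Obligation. by move=> A B X c x y /=; rewrite lactDr. Qed.
Next Obligation. by move=> A B X x c d /=; rewrite lactDl. Qed.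
Next Obligation. by move=> A B X x /=; rewrite lact1. Qed.
Next Obligation. by move=> A B X c d x /=; rewrite lactM. Qed.
Next Obligation. by move=> A B X b x y /=; rewrite ractDl. Qed.
Next Obligation. by move=> A B X x a b /=; rewrite rmorphD ractDr. Qed.
Next Obligation. by move=> A B X x /=; rewrite rmorph1 ract1. Qed.
Next Obligation. by move=> A B X a b x /=; rewrite rmorphM ractM. Qed.
Next Obligation. by move=> A B X c x b /=; rewrite lractA. Qed.
Next Obligation. by move=> A B X c x /=; rewrite lractZ. Qed.

End BimoduleConstructions.

Section TensorBimod.
Variable k : fieldType.
Variables (A B D : kalg k) (X : bimod A B) (Y : bimod B D).

Let T : zmodType := tens (@ract _ _ _ X) (@lact _ _ _ Y).
Let pure : X -> Y -> T := tens_pure _ _.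
Let lift (G : zmodType) (f : X -> Y -> G) : T -> G := tens_lift f.
Let bal (G : zmodType) (f : X -> Y -> G) :=
  balanced (@ract _ _ _ X) (@lact _ _ _ Y) f.

Let ext (G : zmodType) (f g : T -> G) :
  {morph f : x y / x + y} -> {morph g : x y / x + y} ->
  (forall x y, f (pure x y) = g (pure x y)) -> f =1 g.
Proof.
move=> fD gD e t; rewrite -[t]tens_lift_pure !tens_lift_comp //.
by apply: eq_bigr => p _; apply: e.
Qed.

Let tl (a : A) : T -> T := lift (fun x y => pure (a *> x) y).
Let tr (t : T) (d : D) : T := lift (fun x y => pure x (y <* d)) t.

Let pb : bal pure. Proof. exact: tens_pure_balanced. Qed.

Let tlb a : bal (fun x y => pure (a *> x) y).
Proof.
case: pb => p1 p2 p3; split=> [x x' y|x y y'|x r y].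
- by rewrite lactDr p1.
- by rewrite p2.
- by rewrite -lractA p3.
Qed.

Let trb d : bal (fun x y => pure x (y <* d)).
Proof.
case: pb => p1 p2 p3; split=> [x x' y|x y y'|x r y].
- by rewrite p1.
- by rewrite ractDl p2.
- by rewrite lractA p3.
Qed.

Let tlE a x y : tl a (pure x y) = pure (a *> x) y.
Proof. exact: tens_liftE (tlb a) x y. Qed.
Let trE d x y : tr (pure x y) d = pure x (y <* d).
Proof. exact: tens_liftE (trb d) x y. Qed.
Let tlD a : {morph tl a : s t / s + t}.
Proof. exact: tens_liftD (tlb a). Qed.
Let trD d : {morph tr^~ d : s t / s + t}.
Proof. exact: tens_liftD (trb d). Qed.

Let pDl x x' y : pure (x + x') y = pure x y + pure x' y.
Proof. by case: pb. Qed.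
Let pDr x y y' : pure x (y + y') = pure x y + pure x y'.
Proof. by case: pb. Qed.
Let pB x b y : pure (x <* b) y = pure x (b *> y).
Proof. by case: pb. Qed.

Let addf (f g : T -> T) : {morph f : x y / x + y} -> {morph g : x y / x + y} ->
  {morph (fun t => f t + g t) : x y / x + y}.
Proof. by move=> fD gD x y; rewrite fD gD addrACA. Qed.

Let compf (f g : T -> T) : {morph f : x y / x + y} -> {morph g : x y / x + y} ->
  {morph (fun t => f (g t)) : x y / x + y}.
Proof. by move=> fD gD x y; rewrite gD fD. Qed.

Fact tensor_lactDl t : {morph tl^~ t : a b / a + b}.
Proof.
move=> a b; move: t; apply: ext; [exact: tlD | exact: addf|] => x y.
by rewrite !tlE lactDl pDl.
Qed.
Fact tensor_lact1 t : tl 1 t = t.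
Proof. by move: t; apply: ext => // x y; rewrite tlE lact1. Qed.
Fact tensor_lactM a b t : tl (a * b) t = tl a (tl b t).
Proof.
by move: t; apply: ext => [||x y]; [exact: tlD|exact: compf|rewrite !tlE lactM].
Qed.
Fact tensor_ractDr t : {morph tr t : a b / a + b}.
Proof.
move=> a b; move: t.
apply: (@ext _ (tr^~ (a + b))); [exact: trD | exact: addf|] => x y.
by rewrite !trE ractDr pDr.
Qed.
Fact tensor_ract1 t : tr t 1 = t.
Proof. by move: t; apply: (@ext _ (tr^~ 1)) => // x y; rewrite trE ract1. Qed.
Fact tensor_ractM a b t : tr t (a * b) = tr (tr t a) b.
Proof.
move: t; apply: (@ext _ (tr^~ (a * b))) => [||x y]; first exact: trD.
  exact: (@compf (tr^~ b) (tr^~ a)).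
by rewrite !trE ractM.
Qed.
Fact tensor_lractA a t b : tr (tl a t) b = tl a (tr t b).
Proof.
move: t; apply: (@ext _ (fun t => tr (tl a t) b)) => [||x y].
- exact: (@compf (tr^~ b) (tl a)).
- exact: (@compf (tl a) (tr^~ b)).
- by rewrite trE !tlE trE.
Qed.
Fact tensor_lractZ (c : k) t : tl (kalg_unit A c) t = tr t (kalg_unit D c).
Proof.
move: t; apply: (@ext _ (tl (kalg_unit A c)) (tr^~ (kalg_unit D c))) => [||x y];
  [exact: tlD|exact: trD|].
by rewrite tlE trE lractZ pB lractZ.
Qed.

Definition tensor : bimod A D :=
  @Bimod k A D T tl tr tlD tensor_lactDl tensor_lact1 tensor_lactM
    trD tensor_ractDr tensor_ract1 tensor_ractM tensor_lractA tensor_lractZ.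

Definition tpure (x : X) (y : Y) : tensor := pure x y.

Definition tlift (G : zmodType) (f : X -> Y -> G) (t : tensor) : G := lift f t.

Definition tbalanced (G : zmodType) (f : X -> Y -> G) := bal f.

Lemma tpure_balanced : tbalanced tpure. Proof. exact: pb. Qed.

Lemma tpureDl x x' y : tpure (x + x') y = tpure x y + tpure x' y.
Proof. exact: pDl. Qed.
Lemma tpureDr x y y' : tpure x (y + y') = tpure x y + tpure x y'.
Proof. exact: pDr. Qed.
Lemma tpureB x b y : tpure (x <* b) y = tpure x (b *> y).
Proof. exact: pB. Qed.
Lemma tpure_lact a x y : a *> tpure x y = tpure (a *> x) y.
Proof. exact: tlE. Qed.
Lemma tpure_ract d x y : tpure x y <* d = tpure x (y <* d).
Proof. exact: trE. Qed.

Lemma tpure_suml I (r : seq I) (F : I -> X) y :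
  tpure (\sum_(i <- r) F i) y = \sum_(i <- r) tpure (F i) y.
Proof. by apply: (@addm_sum _ _ (tpure^~ y)) => x x'; exact: tpureDl. Qed.
Lemma tpure_sumr I (r : seq I) (F : I -> Y) x :
  tpure x (\sum_(i <- r) F i) = \sum_(i <- r) tpure x (F i).
Proof. by apply: addm_sum => y y'; exact: tpureDr. Qed.

Lemma tliftE (G : zmodType) (f : X -> Y -> G) :
  tbalanced f -> forall x y, tlift f (tpure x y) = f x y.
Proof. by move=> fb x y; exact: tens_liftE. Qed.

Lemma tliftD (G : zmodType) (f : X -> Y -> G) :
  tbalanced f -> {morph tlift f : s t / s + t}.
Proof. exact: tens_liftD. Qed.

Lemma tlift_pure t : tlift tpure t = t.
Proof. exact: tens_lift_pure. Qed.

Lemma tlift_comp (G H : zmodType) (h : G -> H) (f : X -> Y -> G) t :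
  {morph h : x y / x + y} -> h (tlift f t) = tlift (fun x y => h (f x y)) t.
Proof. exact: tens_lift_comp. Qed.

Lemma tlift_addf (G : zmodType) (f g : X -> Y -> G) t :
  tlift (fun x y => f x y + g x y) t = tlift f t + tlift g t.
Proof. exact: big_split. Qed.

Lemma eq_tlift (G : zmodType) (f g : X -> Y -> G) t :
  (forall x y, f x y = g x y) -> tlift f t = tlift g t.
Proof. by move=> e; apply: eq_bigr => p _. Qed.

Lemma tensor_ext (G : zmodType) (f g : tensor -> G) :
  {morph f : x y / x + y} -> {morph g : x y / x + y} ->
  (forall x y, f (tpure x y) = g (tpure x y)) -> f =1 g.
Proof. exact: ext. Qed.

Lemma tlift_lact (G : zmodType) (f : X -> Y -> G) a t : tbalanced f ->
  tlift f (a *> t) = tlift (fun x y => f (a *> x) y) t.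
Proof.
move=> fb; rewrite -[t in LHS]tlift_pure tlift_comp; last exact: lactDr.
rewrite tlift_comp; last exact: tliftD.
by apply: eq_tlift => x y; rewrite tpure_lact tliftE.
Qed.

Lemma tlift_ract (G : zmodType) (f : X -> Y -> G) d t : tbalanced f ->
  tlift f (t <* d) = tlift (fun x y => f x (y <* d)) t.
Proof.
move=> fb; rewrite -[t in LHS]tlift_pure.
rewrite (@tlift_comp _ _ (fun t => t <* d)); last exact: ractDl.
rewrite tlift_comp; last exact: tliftD.
by apply: eq_tlift => x y; rewrite tpure_ract tliftE.
Qed.

End TensorBimod.

Arguments tensor {k A B D} X Y : simpl never.
Arguments tpure {k A B D X Y}.
Arguments tlift {k A B D X Y G}.
Notation "x *t y" := (tpure x y) (at level 40, left associativity).

Section TensorMaps.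
Variable k : fieldType.
Implicit Types A B D E : kalg k.

Definition tmap A A' B D D' (X : bimod A B) (Y : bimod B D)
    (X' : bimod A' B) (Y' : bimod B D') (f : X -> X') (g : Y -> Y')
    (t : tensor X Y) : tensor X' Y' :=
  tlift (fun x y => f x *t g y) t.

Definition tassoc A B D E (X : bimod A B) (Y : bimod B D) (Z : bimod D E)
    (t : tensor (tensor X Y) Z) : tensor X (tensor Y Z) :=
  tlift (fun u z => tlift (fun x y => x *t (y *t z)) u) t.

Section Tmap.
Variables (A A' B D D' : kalg k) (X : bimod A B) (Y : bimod B D).
Variables (X' : bimod A' B) (Y' : bimod B D') (f : X -> X') (g : Y -> Y').
Hypotheses (fl : rlin f) (gl : llin g).

Lemma tmap_balanced : tbalanced (fun x y => f x *t g y).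
Proof.
case: fl gl => fD fB [gD gB]; split=> [x x' y|x y y'|x r y].
- by rewrite fD tpureDl.
- by rewrite gD tpureDr.
- by rewrite fB gB tpureB.
Qed.

Lemma tmapE x y : tmap f g (x *t y) = f x *t g y.
Proof. exact: tliftE tmap_balanced x y. Qed.

Lemma tmapD : {morph tmap f g : s t / s + t}.
Proof. exact: tliftD tmap_balanced. Qed.

End Tmap.

Lemma eq_tmap A A' B D D' (X : bimod A B) (Y : bimod B D)
    (X' : bimod A' B) (Y' : bimod B D') (f f' : X -> X') (g g' : Y -> Y') t :
  f =1 f' -> g =1 g' -> tmap f g t = tmap f' g' t.
Proof. by move=> ef eg; apply: eq_tlift => x y; rewrite ef eg. Qed.

Lemma tmap_comp A A' A'' B D D' D'' (X : bimod A B) (Y : bimod B D)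
    (X' : bimod A' B) (Y' : bimod B D') (X'' : bimod A'' B) (Y'' : bimod B D'')
    (f : X' -> X'') (g : Y' -> Y'') (f' : X -> X') (g' : Y -> Y') t :
  rlin f -> llin g ->
  tmap f g (tmap f' g' t) = tmap (fun x => f (f' x)) (fun y => g (g' y)) t.
Proof.
move=> fl gl; rewrite {2}/tmap tlift_comp; last exact: tmapD.
by apply: eq_tlift => x y; rewrite tmapE.
Qed.

Lemma tmap_llin A B D D' (X X' : bimod A B) (Y : bimod B D) (Y' : bimod B D')
    (f : X -> X') (g : Y -> Y') :
  bilin f -> llin g -> llin (tmap f g).
Proof.
case=> fl fr gl; split; first exact: tmapD.
move=> a t; rewrite /tmap tlift_lact; last exact: tmap_balanced.
rewrite tlift_comp; last exact: lactDr.
by apply: eq_tlift => x y; rewrite tpure_lact; case: fl => _ ->.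
Qed.

Lemma tmap_rlin A A' B D (X : bimod A B) (X' : bimod A' B) (Y Y' : bimod B D)
    (f : X -> X') (g : Y -> Y') :
  rlin f -> bilin g -> rlin (tmap f g).
Proof.
move=> fr [gl gr]; split; first exact: tmapD.
move=> t d; rewrite /tmap tlift_ract; last exact: tmap_balanced.
rewrite (@tlift_comp _ _ _ _ _ _ _ _ (fun t => t <* d)); last exact: ractDl.
by apply: eq_tlift => x y; rewrite tpure_ract; case: gr => _ ->.
Qed.

Section Tassoc.
Variables (A B D E : kalg k).
Variables (X : bimod A B) (Y : bimod B D) (Z : bimod D E).

Let inner (z : Z) : tbalanced (fun (x : X) (y : Y) => x *t (y *t z)).
Proof.
split=> [x x' y|x y y'|x r y].
- by rewrite tpureDl.
- by rewrite tpureDl tpureDr.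
- by rewrite tpureB tpure_lact.
Qed.

Let outer : tbalanced (fun (u : tensor X Y) (z : Z) =>
  tlift (fun x y => x *t (y *t z)) u).
Proof.
split=> [u u' z|u z z'|u r z].
- exact: tliftD (inner z) u u'.
- rewrite -tlift_addf; apply: eq_tlift => x y.
  by rewrite !tpureDr.
- rewrite tlift_ract; last exact: inner.
  by apply: eq_tlift => x y; rewrite tpureB.
Qed.

Lemma tassocE (x : X) (y : Y) (z : Z) :
  tassoc ((x *t y) *t z) = x *t (y *t z).
Proof. by rewrite /tassoc (tliftE outer) (tliftE (inner z)). Qed.

Lemma tassocD : {morph @tassoc _ _ _ _ X Y Z : s t / s + t}.
Proof. exact: tliftD outer. Qed.

End Tassoc.

Lemma tensor_ext3 A B D E (X : bimod A B) (Y : bimod B D) (Z : bimod D E)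
   (G : zmodType) (f g : tensor (tensor X Y) Z -> G) :
  {morph f : x y / x + y} -> {morph g : x y / x + y} ->
  (forall x y z, f ((x *t y) *t z) = g ((x *t y) *t z)) -> f =1 g.
Proof.
move=> fD gD e; apply: tensor_ext => // u z; move: u.
by apply: tensor_ext => [u u'|u u'|x y]; rewrite ?tpureDl ?fD ?gD.
Qed.

End TensorMaps.

Record coring (k : fieldType) (A : kalg k) := Coring {
  cobimod :> bimod A A;
  copr : cobimod -> tensor cobimod cobimod;
  counit : cobimod -> breg A;
  copr_bilin : bilin copr;
  counit_bilin : bilin counit;
  coprA : forall c, tassoc (tmap copr id (copr c)) = tmap id copr (copr c);
  coprKl : forall c, tlift (fun c1 c2 => counit c1 *> c2) (copr c) = c;
  coprKr : forall c, tlift (fun c1 c2 => c1 <* counit c2) (copr c) = c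
}.
Arguments copr {k A} C _ : rename.
Arguments counit {k A} C _ : rename.

(* A right C-comodule that also carries a left action of a k-algebra R by
   colinear maps.  For R = k this is a plain right C-comodule. *)
Record rcomod (k : fieldType) (A : kalg k) (R : kalg k)
    (C : coring A) := Rcomod {
  rbimod :> bimod R A;
  rcoact : rbimod -> tensor rbimod C;
  rcoact_bilin : bilin rcoact;
  rcoactA : forall m,
    tassoc (tmap rcoact id (rcoact m)) = tmap id (copr C) (rcoact m);
  rcoactK : forall m, tlift (fun m0 c => m0 <* counit C c) (rcoact m) = m
}.

(* A left C-comodule that also carries a right action of a k-algebra R by
   colinear maps.  For R = k this is a plain left C-comodule. *)
Record lcomod (k : fieldType) (A : kalg k) (C : coring A)
    (R : kalg k) := Lcomod {
  lbimod :> bimod A R;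
  lcoact : lbimod -> tensor C lbimod;
  lcoact_bilin : bilin lcoact;
  lcoactA : forall v,
    tassoc (tmap (copr C) id (lcoact v)) = tmap id lcoact (lcoact v);
  lcoactK : forall v, tlift (fun c v0 => counit C c *> v0) (lcoact v) = v
}.
Arguments rcoact {k A R C} M _ : rename.
Arguments lcoact {k A C R} V _ : rename.

Section Colinear.
Variables (k : fieldType) (A : kalg k) (C : coring A).
Implicit Types R : kalg k.

(* Linear over A only: the extra actions of R and R' are disregarded. *)
Definition rcolin R R' (M : rcomod R C) (N : rcomod R' C) (f : M -> N) :=
  rlin f /\ forall m, rcoact N (f m) = tmap f id (rcoact M m).

Definition lcolin R R' (V : lcomod C R) (W : lcomod C R') (f : V -> W) :=
  llin f /\ forall v, lcoact W (f v) = tmap id f (lcoact V v).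

End Colinear.

Section ColinearLemmas.
Variable k : fieldType.
Implicit Types A B D E R : kalg k.

Lemma tlift_tmap A A' B D D' (X : bimod A B) (Y : bimod B D)
    (X' : bimod A' B) (Y' : bimod B D') (G : zmodType) (h : X' -> Y' -> G)
    (f : X -> X') (g : Y -> Y') t :
  tbalanced h -> tlift h (tmap f g t) = tlift (fun x y => h (f x) (g y)) t.
Proof.
move=> hb; rewrite /tmap tlift_comp; last exact: tliftD.
by apply: eq_tlift => x y; rewrite tliftE.
Qed.

Lemma tmap_id A B D (X : bimod A B) (Y : bimod B D) (t : tensor X Y) :
  tmap id id t = t.
Proof. exact: tlift_pure. Qed.

Lemma tassoc_nat A A' B D E E' (X : bimod A B) (Y : bimod B D) (Z : bimod D E)
    (X' : bimod A' B) (Y' : bimod B D) (Z' : bimod D E')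
    (f : X -> X') (g : Y -> Y') (h : Z -> Z') t :
  rlin f -> bilin g -> llin h ->
  tassoc (tmap (tmap f g) h t) = tmap f (tmap g h) (tassoc t).
Proof.
move=> fr [gl gr] hl; move: t.
have tr : rlin (tmap f g) by exact: tmap_rlin.
have tl : llin (tmap g h) by exact: tmap_llin.
apply: tensor_ext3 => [s t|s t|x y z].
- by rewrite tmapD // tassocD.
- by rewrite tassocD tmapD.
- by rewrite tmapE // tmapE // !tassocE tmapE // tmapE.
Qed.

Lemma tpure_rlin A B D (X : bimod A B) (Y : bimod B D) (x : X) :
  rlin (fun y : Y => x *t y).
Proof. by split=> [y y'|y d]; rewrite ?tpureDr ?tpure_ract. Qed.

Lemma tpure_llin A B D (X : bimod A B) (Y : bimod B D) (y : Y) :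
  llin (fun x : X => x *t y).
Proof. by split=> [x x'|a x]; rewrite ?tpureDl ?tpure_lact. Qed.

Lemma lact_balanced A B D (X : bimod A B) (Y : bimod B D)
    (f : X -> breg B) : rlin f ->
  tbalanced (fun (x : X) (y : Y) => f x *> y).
Proof.
case=> fD fB; split=> [x x' y|x y y'|x r y]; first by rewrite fD lactDl.
- by rewrite lactDr.
- by rewrite fB /= lactM.
Qed.

Lemma ract_balanced A B D (X : bimod A B) (Y : bimod B D)
    (f : Y -> breg B) : llin f ->
  tbalanced (fun (x : X) (y : Y) => x <* f y).
Proof.
case=> fD fB; split=> [x x' y|x y y'|x r y]; first by rewrite ractDl.
- by rewrite fD ractDr.
- by rewrite fB /= ractM.
Qed.

Lemma rlin_comp A A' A'' B (X : bimod A B) (Y : bimod A' B) (Z : bimod A'' B)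
    (g : Y -> Z) (f : X -> Y) : rlin g -> rlin f -> rlin (fun x => g (f x)).
Proof. by move=> [gD gB] [fD fB]; split=> [x y|x b]; rewrite ?fD ?fB. Qed.

Lemma llin_comp A B B' B'' (X : bimod A B) (Y : bimod A B') (Z : bimod A B'')
    (g : Y -> Z) (f : X -> Y) : llin g -> llin f -> llin (fun x => g (f x)).
Proof. by move=> [gD gB] [fD fB]; split=> [x y|b x]; rewrite ?fD ?fB. Qed.

Lemma rlin_opp A A' B (X : bimod A B) (Y : bimod A' B) (f g : X -> Y) :
  rlin f -> rlin g -> rlin (f - g).
Proof.
move=> [fD fB] [gD gB]; have E z : (f - g) z = f z - g z by [].
split=> [x y|x b]; rewrite !E.
  by rewrite fD gD opprD addrACA.
by rewrite fB gB ractDl (addm_opp (ractDl b)).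
Qed.

Lemma llin_opp A B B' (X : bimod A B) (Y : bimod A B') (f g : X -> Y) :
  llin f -> llin g -> llin (f - g).
Proof.
move=> [fD fB] [gD gB]; have E z : (f - g) z = f z - g z by [].
split=> [x y|b x]; rewrite !E.
  by rewrite fD gD opprD addrACA.
by rewrite fB gB lactDr (addm_opp (lactDr b)).
Qed.

Lemma rlin0 A A' B (X : bimod A B) (Y : bimod A' B) : rlin (0 : X -> Y).
Proof. by split=> [x y|x b]; rewrite /= ?addr0 // ract0. Qed.

Lemma llin0 A B B' (X : bimod A B) (Y : bimod A B') : llin (0 : X -> Y).
Proof. by split=> [x y|x b]; rewrite /= ?addr0 // lact0. Qed.

Variables (A : kalg k) (C : coring A).

Lemma rcolin_comp R R' R'' (M : rcomod R C) (N : rcomod R' C)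
    (P : rcomod R'' C) (g : N -> P) (f : M -> N) :
  rcolin g -> rcolin f -> rcolin (fun m => g (f m)).
Proof.
move=> [gr gc] [fr fc]; split; first exact: rlin_comp.
by move=> m; rewrite gc fc tmap_comp.
Qed.

Lemma lcolin_comp R R' R'' (M : lcomod C R) (N : lcomod C R')
    (P : lcomod C R'') (g : N -> P) (f : M -> N) :
  lcolin g -> lcolin f -> lcolin (fun m => g (f m)).
Proof.
move=> [gr gc] [fr fc]; split; first exact: llin_comp.
by move=> m; rewrite gc fc tmap_comp.
Qed.

Lemma rcolin_id R (M : rcomod R C) : rcolin (@id M).
Proof. by split=> // m; rewrite tmap_id. Qed.

Lemma rcolin_lact R (M : rcomod R C) r : rcolin (fun m : M => r *> m).
Proof.
split=> [|m]; first exact: lact_rlin.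
by case: (rcoact_bilin M) => -[_ ->].
Qed.

Lemma lcolin_ract R (V : lcomod C R) r : lcolin (fun v : V => v <* r).
Proof.
split=> [|m]; first exact: ract_llin.
by case: (lcoact_bilin V) => _ [_ ->].
Qed.

End ColinearLemmas.

(* Hom^{-C}(M, N), with (s f r)(m) = s (f (r m)) *)
Section RightHom.
Variables (k : fieldType) (A : kalg k) (C : coring A) (R R' : kalg k).
Variables (M : rcomod R C) (N : rcomod R' C).

Definition rcolin_pred : {pred M -> N} := [pred f | `[< rcolin f >]].

Record rhom := Rhom { rhom_fun :> M -> N; _ : rhom_fun \in rcolin_pred }.

Lemma rcolin_predP (f : M -> N) : reflect (rcolin f) (f \in rcolin_pred).
Proof. by rewrite inE; exact: asboolP. Qed.

HB.instance Definition _ := [isSub for rhom_fun].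
HB.instance Definition _ := [Choice of rhom by <:].

Fact rcolin_zmod : zmod_closed rcolin_pred.
Proof.
split.
  apply/rcolin_predP; split=> [|m]; first exact: rlin0.
  rewrite /= (addm0 (rcoact_bilin N).1.1) /tmap /tlift /tens_lift big1 //.
  by move=> p _; apply: (@addm0 _ _ (fun x : N => x *t p.2)) => x y; exact: tpureDl.
move=> f g /rcolin_predP [fr fc] /rcolin_predP [gr gc]; apply/rcolin_predP.
split=> [|m]; first exact: rlin_opp.
have cD := (rcoact_bilin N).1.1.
have E z : (f - g) z = f z - g z by [].
rewrite E cD (addm_opp cD) fc gc /tmap -sumrB.
apply: eq_bigr => -[m0 c] _.
have pD : {morph (fun x : N => x *t c) : x y / x + y} by move=> x y; exact: tpureDl.
by rewrite /= pD (addm_opp pD).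
Qed.
HB.instance Definition _ := GRing.isZmodClosed.Build (M -> N) rcolin_pred rcolin_zmod.
HB.instance Definition _ := [SubChoice_isSubZmodule of rhom by <:].

Lemma rhomP (f : rhom) : rcolin f.
Proof. by apply/rcolin_predP; case: f. Qed.

Definition mkrhom (f : M -> N) (fP : rcolin f) : rhom :=
  Rhom (introT (rcolin_predP f) fP).

Lemma rhom_ext (f g : rhom) : f =1 g -> f = g.
Proof. by move=> e; apply: val_inj; apply/funext. Qed.

Lemma rhomDE (f g : rhom) m : (f + g) m = f m + g m. Proof. by []. Qed.

Lemma rhomD (f : rhom) : {morph f : x y / x + y}.
Proof. by case: (rhomP f) => -[]. Qed.

Lemma rhom_ract (f : rhom) m a : f (m <* a) = f m <* a.
Proof. by case: (rhomP f) => -[_ ->]. Qed.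

Definition rhom_lact (s : R') (f : rhom) : rhom :=
  mkrhom (rcolin_comp (rcolin_lact N s) (rhomP f)).
Definition rhom_ractr (f : rhom) (r : R) : rhom :=
  mkrhom (rcolin_comp (rhomP f) (rcolin_lact M r)).

Program Definition rhom_bimod : bimod R' R :=
  @Bimod k R' R rhom rhom_lact rhom_ractr _ _ _ _ _ _ _ _ _ _.
Next Obligation. by move=> s f g; apply: rhom_ext => m /=; rewrite lactDr. Qed.
Next Obligation. by move=> f s t; apply: rhom_ext => m /=; rewrite lactDl. Qed.
Next Obligation. by move=> f; apply: rhom_ext => m /=; rewrite lact1. Qed.
Next Obligation. by move=> s t f; apply: rhom_ext => m /=; rewrite lactM. Qed.
Next Obligation. by move=> r f g; apply: rhom_ext. Qed.
Next Obligation. by move=> f r s; apply: rhom_ext => m /=; rewrite lactDl rhomD. Qed.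
Next Obligation. by move=> f; apply: rhom_ext => m /=; rewrite lact1. Qed.
Next Obligation. by move=> r s f; apply: rhom_ext => m /=; rewrite lactM. Qed.
Next Obligation. by move=> s f r; apply: rhom_ext. Qed.
Next Obligation.
by move=> c f; apply: rhom_ext => m /=; rewrite !lractZ rhom_ract.
Qed.

End RightHom.

(* Hom^{C-}(V, W), with (r f s)(v) = f (v r) s *)
Section LeftHom.
Variables (k : fieldType) (A : kalg k) (C : coring A) (R R' : kalg k).
Variables (V : lcomod C R) (W : lcomod C R').

Definition lcolin_pred : {pred V -> W} := [pred f | `[< lcolin f >]].

Record lhom := Lhom { lhom_fun :> V -> W; _ : lhom_fun \in lcolin_pred }.

Lemma lcolin_predP (f : V -> W) : reflect (lcolin f) (f \in lcolin_pred).
Proof. by rewrite inE; exact: asboolP. Qed.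

HB.instance Definition _ := [isSub for lhom_fun].
HB.instance Definition _ := [Choice of lhom by <:].

Fact lcolin_zmod : zmod_closed lcolin_pred.
Proof.
split.
  apply/lcolin_predP; split=> [|m]; first exact: llin0.
  rewrite /= (addm0 (lcoact_bilin W).1.1) /tmap /tlift /tens_lift big1 //.
  by move=> p _; apply: (@addm0 _ _ (fun x : W => p.1 *t x)) => x y; exact: tpureDr.
move=> f g /lcolin_predP [fr fc] /lcolin_predP [gr gc]; apply/lcolin_predP.
split=> [|m]; first exact: llin_opp.
have cD := (lcoact_bilin W).1.1.
have E z : (f - g) z = f z - g z by [].
rewrite E cD (addm_opp cD) fc gc /tmap -sumrB.
apply: eq_bigr => -[c m0] _.
have pD : {morph (fun x : W => c *t x) : x y / x + y} by move=> x y; exact: tpureDr.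
by rewrite /= pD (addm_opp pD).
Qed.
HB.instance Definition _ := GRing.isZmodClosed.Build (V -> W) lcolin_pred lcolin_zmod.
HB.instance Definition _ := [SubChoice_isSubZmodule of lhom by <:].

Lemma lhomP (f : lhom) : lcolin f.
Proof. by apply/lcolin_predP; case: f. Qed.

Definition mklhom (f : V -> W) (fP : lcolin f) : lhom :=
  Lhom (introT (lcolin_predP f) fP).

Lemma lhom_ext (f g : lhom) : f =1 g -> f = g.
Proof. by move=> e; apply: val_inj; apply/funext. Qed.

Lemma lhomDE (f g : lhom) m : (f + g) m = f m + g m. Proof. by []. Qed.

Lemma lhomD (f : lhom) : {morph f : x y / x + y}.
Proof. by case: (lhomP f) => -[]. Qed.

Lemma lhom_lact (f : lhom) a v : f (a *> v) = a *> f v.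
Proof. by case: (lhomP f) => -[_ ->]. Qed.

Definition lhom_lactr (r : R) (f : lhom) : lhom :=
  mklhom (lcolin_comp (lhomP f) (lcolin_ract V r)).
Definition lhom_ract (f : lhom) (s : R') : lhom :=
  mklhom (lcolin_comp (lcolin_ract W s) (lhomP f)).

Program Definition lhom_bimod : bimod R R' :=
  @Bimod k R R' lhom lhom_lactr lhom_ract _ _ _ _ _ _ _ _ _ _.
Next Obligation. by move=> s f g; apply: lhom_ext. Qed.
Next Obligation. by move=> f s t; apply: lhom_ext => m /=; rewrite ractDr lhomD. Qed.
Next Obligation. by move=> f; apply: lhom_ext => m /=; rewrite ract1. Qed.
Next Obligation. by move=> s t f; apply: lhom_ext => m /=; rewrite ractM. Qed.
Next Obligation. by move=> r f g; apply: lhom_ext => m /=; rewrite ractDl. Qed.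
Next Obligation. by move=> f r s; apply: lhom_ext => m /=; rewrite ractDr. Qed.
Next Obligation. by move=> f; apply: lhom_ext => m /=; rewrite ract1. Qed.
Next Obligation. by move=> r s f; apply: lhom_ext => m /=; rewrite ractM. Qed.
Next Obligation. by move=> s f r; apply: lhom_ext. Qed.
Next Obligation.
by move=> c f; apply: lhom_ext => m /=; rewrite -!lractZ lhom_lact.
Qed.

End LeftHom.

Section ComoduleConstructions.
Variables (k : fieldType) (A : kalg k) (C : coring A).
Implicit Types Q R : kalg k.

Definition coring_rcomod : rcomod A C :=
  @Rcomod k A A C C (copr C) (copr_bilin C) (@coprA k A C) (@coprKr k A C).

(* X (x)_R M with coaction x (x) m |-> sum (x (x) m_0) (x) m_1 *)
Section TensorRight.
Variables (Q R : kalg k) (X : bimod Q R) (M : rcomod R C).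

Definition rtens_coact (t : tensor X M) : tensor (tensor X M) C :=
  tlift (fun x m => tmap (fun m0 => x *t m0) id (rcoact M m)) t.

Let ME := (rcoact_bilin M).

Fact rtens_balanced : tbalanced (fun (x : X) (m : M) =>
  tmap (fun m0 => x *t m0) (@id C) (rcoact M m) : tensor (tensor X M) C).
Proof.
case: ME => -[cD cl] _.
split=> [x x' m|x m m'|x r m].
- by rewrite /tmap -tlift_addf; apply: eq_tlift => m0 c; rewrite !tpureDl.
- by rewrite cD tmapD //; exact: tpure_rlin.
- rewrite cl [in RHS]/tmap tlift_lact; last exact: tmap_balanced (tpure_rlin _ _) (llin_id _).
  by apply: eq_tlift => m0 c; rewrite tpureB.
Qed.

Lemma rtens_coactE x m :
  rtens_coact (x *t m) = tmap (fun m0 => x *t m0) id (rcoact M m).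
Proof. exact: tliftE rtens_balanced x m. Qed.

Lemma rtens_coactD : {morph rtens_coact : s t / s + t}.
Proof. exact: tliftD rtens_balanced. Qed.

Fact rtens_bilin : bilin rtens_coact.
Proof.
case: (ME) => _ [_ cr].
split; split; try exact: rtens_coactD.
- move=> q t; rewrite /rtens_coact tlift_lact; last exact: rtens_balanced.
  rewrite tlift_comp; last exact: lactDr.
  apply: eq_tlift => x m; rewrite /tmap tlift_comp; last exact: lactDr.
  by apply: eq_tlift => m0 c; rewrite !tpure_lact.
- move=> t a; rewrite /rtens_coact tlift_ract; last exact: rtens_balanced.
  rewrite (@tlift_comp _ _ _ _ _ _ _ _ (fun t => t <* a)); last exact: ractDl.
  apply: eq_tlift => x m; rewrite cr.
  by have [_ ->] := tmap_rlin (tpure_rlin M x) (conj (llin_id C) (rlin_id C)).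
Qed.

Fact rtens_coactA t : tassoc (tmap rtens_coact id (rtens_coact t)) =
  tmap id (copr C) (rtens_coact t).
Proof.
have [tl tr] := rtens_bilin; have [cl cr] := copr_bilin C.
move: t; apply: tensor_ext => [s t|s t|x m].
- by rewrite rtens_coactD tmapD // tassocD.
- by rewrite rtens_coactD tmapD.
have fr := tpure_rlin M x.
have fr' : rlin (tmap (fun m0 : M => x *t m0) (@id C)) by exact: tmap_rlin.
transitivity (tassoc (tmap (tmap (fun m0 : M => x *t m0) (@id C)) (@id C)
    (tmap (rcoact M) (@id C) (rcoact M m)))).
  rewrite rtens_coactE !tmap_comp //; congr tassoc.
  by apply: eq_tmap => // m0; exact: rtens_coactE.
have il : llin (tmap (@id C) (@id C)) by exact: tmap_llin.
rewrite tassoc_nat // rcoactA rtens_coactE !tmap_comp //.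
by apply: eq_tmap => // u; exact: tmap_id.
Qed.

Fact rtens_coactK t :
  tlift (fun u c => u <* counit C c) (rtens_coact t) = t.
Proof.
have [el _] := counit_bilin C.
have eb Q' (Y : bimod Q' A) := ract_balanced Y el.
move: t; apply: tensor_ext => [s t|s t|x m] //.
- by rewrite rtens_coactD tliftD.
- rewrite rtens_coactE tlift_tmap //.
  rewrite -[m in RHS](rcoactK m) tlift_comp.
    by apply: eq_tlift => m0 c; rewrite tpure_ract.
  by move=> y y'; rewrite tpureDr.
Qed.

Definition rtens : rcomod Q C :=
  Rcomod rtens_bilin rtens_coactA rtens_coactK.

End TensorRight.

(* V (x)_R X with coaction v (x) x |-> sum v_(-1) (x) (v_0 (x) x) *)
Section TensorLeft.
Variables (Q R : kalg k) (V : lcomod C R) (X : bimod R Q).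

Definition ltens_coact (t : tensor V X) : tensor C (tensor V X) :=
  tlift (fun v x => tmap id (fun v0 => v0 *t x) (lcoact V v)) t.

Let VE := (lcoact_bilin V).

Fact ltens_balanced : tbalanced (fun (v : V) (x : X) =>
  tmap (@id C) (fun v0 => v0 *t x) (lcoact V v) : tensor C (tensor V X)).
Proof.
case: VE => _ [cD cr].
split=> [v v' x|v x x'|v r x].
- by rewrite cD tmapD //; exact: tpure_llin.
- by rewrite /tmap -tlift_addf; apply: eq_tlift => c v0; rewrite !tpureDr.
- rewrite cr [in LHS]/tmap tlift_ract; last exact: tmap_balanced (rlin_id _) (tpure_llin _ _).
  by apply: eq_tlift => c v0; rewrite tpureB.
Qed.

Lemma ltens_coactE v x :
  ltens_coact (v *t x) = tmap id (fun v0 => v0 *t x) (lcoact V v).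
Proof. exact: tliftE ltens_balanced v x. Qed.

Lemma ltens_coactD : {morph ltens_coact : s t / s + t}.
Proof. exact: tliftD ltens_balanced. Qed.

Fact ltens_bilin : bilin ltens_coact.
Proof.
case: (VE) => -[_ cl] _.
split; split; try exact: ltens_coactD.
- move=> a t; rewrite /ltens_coact tlift_lact; last exact: ltens_balanced.
  rewrite tlift_comp; last exact: lactDr.
  apply: eq_tlift => v x; rewrite cl.
  by have [_ ->] := tmap_llin (conj (llin_id C) (rlin_id C)) (tpure_llin V x).
- move=> t q; rewrite /ltens_coact tlift_ract; last exact: ltens_balanced.
  rewrite (@tlift_comp _ _ _ _ _ _ _ _ (fun t => t <* q)); last exact: ractDl.
  apply: eq_tlift => v x; rewrite /tmap.
  rewrite (@tlift_comp _ _ _ _ _ _ _ _ (fun t => t <* q)); last exact: ractDl.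
  by apply: eq_tlift => c v0; rewrite !tpure_ract.
Qed.

Fact ltens_coactA t : tassoc (tmap (copr C) id (ltens_coact t)) =
  tmap id ltens_coact (ltens_coact t).
Proof.
have [tl tr] := ltens_bilin; have [cl cr] := copr_bilin C.
move: t; apply: tensor_ext => [s t|s t|v x].
- by rewrite ltens_coactD tmapD // tassocD.
- by rewrite ltens_coactD tmapD.
have fl := tpure_llin V x.
have fl' : llin (tmap (@id C) (fun v0 : V => v0 *t x)) by exact: tmap_llin.
transitivity (tmap (@id C) (tmap (@id C) (fun v0 : V => v0 *t x))
    (tmap (@id C) (lcoact V) (lcoact V v))); last first.
  rewrite ltens_coactE !tmap_comp //.
  by apply: eq_tmap => // v0; rewrite ltens_coactE.
have ir : rlin (tmap (@id C) (@id C)) by exact: tmap_rlin.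
rewrite -lcoactA -tassoc_nat // ltens_coactE !tmap_comp //.
by congr tassoc; apply: eq_tmap => // c; rewrite tmap_id.
Qed.

Fact ltens_coactK t :
  tlift (fun c u => counit C c *> u) (ltens_coact t) = t.
Proof.
have [_ er] := counit_bilin C.
have eb Q' (Y : bimod A Q') := lact_balanced Y er.
move: t; apply: tensor_ext => [s t|s t|v x] //.
- by rewrite ltens_coactD tliftD.
- rewrite ltens_coactE tlift_tmap //.
  rewrite -[v in RHS](lcoactK v) (@tlift_comp _ _ _ _ _ _ _ _ (fun v => v *t x)).
    by apply: eq_tlift => c v0; rewrite tpure_lact.
  by move=> y y'; rewrite tpureDl.
Qed.

Definition ltens : lcomod C Q :=
  Lcomod ltens_bilin ltens_coactA ltens_coactK.

End TensorLeft.

Section Forget.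
Variables (R : kalg k) (V : lcomod C R).

Fact lforget_bilin :
  @bilin k A (ground k) (leftmod V) (tensor C (leftmod V)) (lcoact V).
Proof.
case: (lcoact_bilin V) => cl [cD cr]; split; first exact: cl.
split; first exact: cD.
by move=> v c; exact: (cr v (kalg_unit R c)).
Qed.

Definition lforget : lcomod C (ground k) :=
  @Lcomod k A C (ground k) (leftmod V) (lcoact V)
    lforget_bilin (@lcoactA _ _ _ _ V) (@lcoactK _ _ _ _ V).

End Forget.

End ComoduleConstructions.

Section Endomorphisms.
Variables (k : fieldType) (A : kalg k) (C : coring A).
Variable M : rcomod (ground k) C.

Definition endo_type := rhom M M.
HB.instance Definition _ := GRing.Zmodule.on endo_type.

Definition endo_one : endo_type := mkrhom (rcolin_id M).
Definition endo_mul (f g : endo_type) : endo_type :=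
  mkrhom (rcolin_comp (rhomP f) (rhomP g)).

Fact endo_mulA : associative endo_mul. Proof. by move=> f g h; exact: rhom_ext. Qed.
Fact endo_mul1l : left_id endo_one endo_mul. Proof. by move=> f; exact: rhom_ext. Qed.
Fact endo_mul1r : right_id endo_one endo_mul. Proof. by move=> f; exact: rhom_ext. Qed.
Fact endo_mulDl : left_distributive endo_mul +%R.
Proof. by move=> f g h; exact: rhom_ext. Qed.
Fact endo_mulDr : right_distributive endo_mul +%R.
Proof. by move=> f g h; apply: rhom_ext => m /=; rewrite rhomD. Qed.

HB.instance Definition _ := GRing.Zmodule_isPzRing.Build endo_type
  endo_mulA endo_mul1l endo_mul1r endo_mulDl endo_mulDr.

Definition endo_scalar (c : k) : endo_type := mkrhom (rcolin_lact M (c : ground k)).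

Fact endo_scalar_zmod : zmod_morphism endo_scalar.
Proof.
move=> c d; apply: rhom_ext => m /=.
have lD := @lactDl _ _ _ M m.
by rewrite (lD (c : ground k) (- d : ground k)) (addm_opp lD).
Qed.

Fact endo_scalar_monoid : monoid_morphism endo_scalar.
Proof.
split=> [|c d]; apply: rhom_ext => m /=; first exact: lact1.
exact: (@lactM k (ground k) A M c d m).
Qed.

HB.instance Definition _ :=
  GRing.isZmodMorphism.Build k endo_type endo_scalar endo_scalar_zmod.
HB.instance Definition _ :=
  GRing.isMonoidMorphism.Build k endo_type endo_scalar endo_scalar_monoid.

Fact endo_central (c : k) (f : endo_type) : endo_scalar c * f = f * endo_scalar c.
Proof.
apply: rhom_ext => m /=.
have z m' := @lractZ k (ground k) A M c m'.
by rewrite (z (f m)) (z m) rhom_ract.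
Qed.

Definition endo : kalg k := @KAlg k endo_type endo_scalar endo_central.

(* M as an (S, A)-bimodule and comodule, s m = s(m) *)
Program Definition endo_bimod : bimod endo A :=
  @Bimod k endo A M (fun s m => rhom_fun s m) (fun m a => m <* a)
    _ _ _ _ _ _ _ _ _ _.
Next Obligation. by move=> s m m' /=; exact: rhomD. Qed.
Next Obligation. by []. Qed.
Next Obligation. by []. Qed.
Next Obligation. by []. Qed.
Next Obligation. exact: ractDl. Qed.
Next Obligation. exact: ractDr. Qed.
Next Obligation. exact: ract1. Qed.
Next Obligation. exact: ractM. Qed.
Next Obligation. by move=> s m a /=; rewrite rhom_ract. Qed.
Next Obligation. by move=> c m /=; exact: (@lractZ k (ground k) A M c m). Qed.

Fact endo_bilin :
  @bilin k endo A endo_bimod (tensor endo_bimod C) (rcoact M).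
Proof.
case: (rcoact_bilin M) => cl cr; split; last exact: cr.
split; first by case: cl.
by move=> s m; case: (rhomP s) => _; apply.
Qed.

Definition endo_rcomod : rcomod endo C :=
  @Rcomod k A endo C endo_bimod (rcoact M)
    endo_bilin (@rcoactA _ _ _ _ M) (@rcoactK _ _ _ _ M).

End Endomorphisms.

(* Hom_{-A}(M, A), with (a xi r)(m) = a xi(r m) *)
Section Dual.
Variables (k : fieldType) (R A : kalg k) (M : bimod R A).

Definition rlin_pred : {pred M -> breg A} := [pred f | `[< rlin f >]].

Record dual_type := Dual { dual_fun :> M -> breg A; _ : dual_fun \in rlin_pred }.

Lemma rlin_predP (f : M -> breg A) : reflect (rlin f) (f \in rlin_pred).
Proof. by rewrite inE; exact: asboolP. Qed.

HB.instance Definition _ := [isSub for dual_fun].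
HB.instance Definition _ := [Choice of dual_type by <:].

Fact rlin_zmod : zmod_closed rlin_pred.
Proof.
split; first by apply/rlin_predP; exact: rlin0.
by move=> f g /rlin_predP fr /rlin_predP gr; apply/rlin_predP; exact: rlin_opp.
Qed.
HB.instance Definition _ := GRing.isZmodClosed.Build (M -> breg A) rlin_pred rlin_zmod.
HB.instance Definition _ := [SubChoice_isSubZmodule of dual_type by <:].

Lemma dualP (f : dual_type) : rlin f.
Proof. by apply/rlin_predP; case: f. Qed.

Definition mkdual (f : M -> breg A) (fP : rlin f) : dual_type :=
  Dual (introT (rlin_predP f) fP).

Lemma dual_ext (f g : dual_type) : f =1 g -> f = g.
Proof. by move=> e; apply: val_inj; apply/funext. Qed.

Lemma dualD (f : dual_type) : {morph f : x y / x + y}.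
Proof. by case: (dualP f). Qed.

Lemma dual_ractE (f : dual_type) m a : f (m <* a) = f m * a.
Proof. by case: (dualP f) => _ ->. Qed.

Definition dual_lact (a : A) (f : dual_type) : dual_type :=
  mkdual (rlin_comp (lact_rlin (breg A) a) (dualP f)).
Definition dual_ract (f : dual_type) (r : R) : dual_type :=
  mkdual (rlin_comp (dualP f) (lact_rlin M r)).

Program Definition dual : bimod A R :=
  @Bimod k A R dual_type dual_lact dual_ract _ _ _ _ _ _ _ _ _ _.
Next Obligation. by move=> s f g; apply: dual_ext => m /=; rewrite mulrDr. Qed.
Next Obligation. by move=> f s t; apply: dual_ext => m /=; rewrite mulrDl. Qed.
Next Obligation. by move=> f; apply: dual_ext => m /=; rewrite mul1r. Qed.
Next Obligation. by move=> s t f; apply: dual_ext => m /=; rewrite mulrA. Qed.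
Next Obligation. by move=> r f g; apply: dual_ext. Qed.
Next Obligation. by move=> f r s; apply: dual_ext => m /=; rewrite lactDl dualD. Qed.
Next Obligation. by move=> f; apply: dual_ext => m /=; rewrite lact1. Qed.
Next Obligation. by move=> r s f; apply: dual_ext => m /=; rewrite lactM. Qed.
Next Obligation. by move=> s f r; apply: dual_ext. Qed.
Next Obligation.
by move=> c f; apply: dual_ext => m /=; rewrite lractZ dual_ractE kalg_central.
Qed.

Record dual_basis := DualBasis {
  db_size : nat;
  db_vec : 'I_db_size -> M;
  db_cov : 'I_db_size -> dual;
  dual_basisP : forall m : M, m = \sum_i db_vec i <* (db_cov i : dual_type) m
}.

Arguments db_vec : clear implicits.
Arguments db_cov : clear implicits.

Lemma dual_sumE I (r : seq I) (F : I -> dual) m :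
  (\sum_(i <- r) F i : dual_type) m = \sum_(i <- r) (F i : dual_type) m.
Proof. by apply: (@addm_sum _ _ (fun f : dual_type => f m)). Qed.

Lemma dual_basis_cov (b : dual_basis) (f : dual) :
  f = \sum_i (f : dual_type) (db_vec b i) *> db_cov b i.
Proof.
apply: dual_ext => m; rewrite [RHS]dual_sumE.
rewrite {1}(dual_basisP b m) (addm_sum _ _ (dualD _)).
by apply: eq_bigr => i _; exact: dual_ractE.
Qed.

End Dual.
Arguments db_vec {k R A M} b i : rename.
Arguments db_cov {k R A M} b i : rename.

(* The left coaction xi |-> sum_i xi(e^i_0) e^i_1 (x) xi^i on M^* *)
Section DualComodule.
Variables (k : fieldType) (A : kalg k) (C : coring A) (R : kalg k).
Variables (M : rcomod R C) (b : dual_basis M).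

(* m |-> sum xi(m_0) m_1 *)
Definition dual_contract (xi : dual M) (m : M) : C :=
  tlift (fun m0 c => (xi : dual_type M) m0 *> c) (rcoact M m).

Definition dual_coact (xi : dual M) : tensor C (dual M) :=
  \sum_i dual_contract xi (db_vec b i) *t db_cov b i.

Let bal (xi : dual M) : tbalanced (fun (m0 : M) (c : C) => (xi : dual_type M) m0 *> c).
Proof. exact: lact_balanced (dualP _). Qed.

Lemma dual_contractD xi : {morph dual_contract xi : x y / x + y}.
Proof.
by move=> x y; rewrite /dual_contract (rcoact_bilin M).1.1 tliftD.
Qed.

Lemma dual_contract_rlin xi : rlin (dual_contract xi).
Proof.
split=> [|m a]; first exact: dual_contractD.
rewrite /dual_contract (rcoact_bilin M).2.2 tlift_ract //.
rewrite (@tlift_comp _ _ _ _ _ _ _ _ (fun c => c <* a)); last exact: ractDl.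
by apply: eq_tlift => m0 c; rewrite lractA.
Qed.

Lemma dual_contractDl m : {morph dual_contract^~ m : xi zeta / xi + zeta}.
Proof.
move=> xi zeta; rewrite /dual_contract -tlift_addf; apply: eq_tlift => m0 c.
exact: lactDl.
Qed.

Lemma dual_contract_lact a xi m :
  dual_contract (a *> xi) m = a *> dual_contract xi m.
Proof.
rewrite /dual_contract tlift_comp; last exact: lactDr.
by apply: eq_tlift => m0 c; rewrite /= lactM.
Qed.

Lemma dual_contract_ract r xi m :
  dual_contract (xi <* r) m = dual_contract xi (r *> m).
Proof. by rewrite /dual_contract (rcoact_bilin M).1.2 tlift_lact. Qed.

(* M -> C, m |-> sum xi(m_0) m_1, is colinear *)
Lemma dual_contract_copr xi m :
  copr C (dual_contract xi m) = tmap (dual_contract xi) id (rcoact M m).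
Proof.
have [[cD cl] cr] := copr_bilin C.
pose h (m0 : M) (u : tensor C C) : tensor C C := (xi : dual_type M) m0 *> u.
have hb : tbalanced h by exact: lact_balanced (dualP _).
rewrite /dual_contract tlift_comp //.
transitivity (tlift h (tmap id (copr C) (rcoact M m))).
  by rewrite tlift_tmap //; apply: eq_tlift => m0 c; rewrite cl.
rewrite -rcoactA; move: (rcoact M m).
have [[dD dl] dr] := rcoact_bilin M.
apply: tensor_ext => [s t|s t|m0 c].
- by rewrite tmapD // tassocD tliftD.
- by rewrite tmapD //; exact: dual_contract_rlin.
rewrite tmapE //= tmapE //; last exact: dual_contract_rlin.
rewrite /dual_contract (@tlift_comp _ _ _ _ _ _ _ _ (fun d => d *t c));
  last by move=> x y; exact: tpureDl.
rewrite -[X in X *t c]tlift_pure.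
rewrite (@tlift_comp _ _ _ _ _ _ _ _ (fun u => tlift h (tassoc (u *t c)))).
  apply: eq_tlift => m1 c1; rewrite tassocE tliftE // /h.
  by rewrite tpure_lact.
by move=> x y; rewrite tpureDl tassocD tliftD.
Qed.

(* sum e^i (x) xi^i(m_0) m_1 recovers the coaction of M *)
Lemma dual_basis_coact m :
  rcoact M m = \sum_i db_vec b i *t dual_contract (db_cov b i) m.
Proof.
rewrite -[LHS]tlift_pure /dual_contract.
rewrite (eq_bigr (fun i => tlift (fun m0 c =>
   db_vec b i *t ((db_cov b i : dual_type M) m0 *> c)) (rcoact M m))); last first.
  by move=> i _; rewrite tlift_comp // => x y; exact: tpureDr.
rewrite /tlift /tens_lift exchange_big; apply: eq_bigr => p _ /=.
rewrite {1}(dual_basisP b p.1) tpure_suml; apply: eq_bigr => i _.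
exact: tpureB.
Qed.

Fact dual_coact_bilin : bilin dual_coact.
Proof.
have D : {morph dual_coact : x y / x + y}.
  move=> x y; rewrite /dual_coact -big_split; apply: eq_bigr => i _ /=.
  by rewrite dual_contractDl tpureDl.
split; split=> //.
  move=> a xi; rewrite /dual_coact lact_sumr; apply: eq_bigr => i _.
  by rewrite dual_contract_lact tpure_lact.
move=> xi r; rewrite /dual_coact ract_suml.
under eq_bigr => i _.
  rewrite dual_contract_ract (dual_basisP b (r *> db_vec b i)).
  rewrite (addm_sum _ _ (dual_contractD xi)) tpure_suml.
  under eq_bigr => j _ do rewrite (dual_contract_rlin xi).2 tpureB.
  over.
rewrite exchange_big; apply: eq_bigr => j _.
rewrite tpure_ract [in RHS](dual_basis_cov b (_ <* r)) tpure_sumr.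
by apply: eq_bigr.
Qed.

Fact dual_coactA xi :
  tassoc (tmap (copr C) id (dual_coact xi)) = tmap id dual_coact (dual_coact xi).
Proof.
have [cl cr] := copr_bilin C; have [dl dr] := dual_coact_bilin.
rewrite {1 3}/dual_coact.
rewrite (addm_sum _ _ (tmapD cr (llin_id _))) (addm_sum _ _ (@tassocD _ _ _ _ _ _ _ _)).
rewrite (addm_sum _ _ (tmapD (rlin_id _) dl)).
under eq_bigr => j _.
  rewrite tmapE // dual_contract_copr dual_basis_coact.
  rewrite (addm_sum _ _ (tmapD (dual_contract_rlin xi) (llin_id _))).
  rewrite tpure_suml (addm_sum _ _ (@tassocD _ _ _ _ _ _ _ _)).
  under eq_bigr => i _.
    rewrite tmapE //; last exact: dual_contract_rlin.
    rewrite tassocE.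
    over.
  over.
rewrite exchange_big; apply: eq_bigr => i _ /=.
by rewrite tmapE // /dual_coact tpure_sumr.
Qed.

Fact dual_coactK xi :
  tlift (fun c zeta => counit C c *> zeta) (dual_coact xi) = xi.
Proof.
have [el er] := counit_bilin C.
have eb := lact_balanced (dual M) er.
rewrite /dual_coact (addm_sum _ _ (tliftD eb)) [RHS](dual_basis_cov b).
apply: eq_bigr => i _; rewrite tliftE //; congr (_ *> _).
rewrite /dual_contract tlift_comp; last by case: el.
rewrite -[in RHS](rcoactK (db_vec b i)) tlift_comp; last exact: dualD.
by apply: eq_tlift => m0 c; rewrite dual_ractE el.2.
Qed.

Definition dual_lcomod : lcomod C R :=
  Lcomod dual_coact_bilin dual_coactA dual_coactK.

End DualComodule.

Section ModuleProperties.
Variables (k : fieldType) (A B : kalg k).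

Definition fg_right (X : bimod A B) : Prop :=
  exists (n : nat) (x : 'I_n -> X),
    forall y, exists b : 'I_n -> B, y = \sum_i x i <* b i.

Definition fg_left (X : bimod A B) : Prop :=
  exists (n : nat) (x : 'I_n -> X),
    forall y, exists a : 'I_n -> A, y = \sum_i a i *> x i.

Definition surj (U V : Type) (g : U -> V) := forall v, exists u, g u = v.

Definition projective_right (X : bimod A B) : Prop :=
  forall (Y Z : bimod (ground k) B) (g : Y -> Z) (f : X -> Z),
    rlin g -> surj g -> rlin f ->
    exists h : X -> Y, rlin h /\ forall x, g (h x) = f x.

Definition projective_left (X : bimod A B) : Prop :=
  forall (Y Z : bimod A (ground k)) (g : Y -> Z) (f : X -> Z),
    llin g -> surj g -> llin f ->
    exists h : X -> Y, llin h /\ forall x, g (h x) = f x.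

Definition exact_seq (U V W : zmodType) (f : U -> V) (g : V -> W) : Prop :=
  forall v, g v = 0 <-> exists u, f u = v.

(* A sequence of right A-modules is exact iff its image under - (x)_A X is. *)
Definition faithfully_flat_left (X : bimod A B) : Prop :=
  forall (U V W : bimod (ground k) A) (f : U -> V) (g : V -> W),
    rlin f -> rlin g ->
    (exact_seq f g <->
     exact_seq (tmap f (@id X) : tensor U X -> tensor V X)
               (tmap g (@id X) : tensor V X -> tensor W X)).

(* A sequence of left B-modules is exact iff its image under X (x)_B - is. *)
Definition faithfully_flat_right (X : bimod A B) : Prop :=
  forall (U V W : bimod B (ground k)) (f : U -> V) (g : V -> W),
    llin f -> llin g ->
    (exact_seq f g <->
     exact_seq (tmap (@id X) f : tensor X U -> tensor X V)
               (tmap (@id X) g : tensor X V -> tensor X W)).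

End ModuleProperties.

Section DualBasisLemma.
Variables (k : fieldType) (R A : kalg k) (M : bimod R A).

Section FreeModule.
Variable n : nat.
Let F := {ffun 'I_n -> A}.
Program Definition free_right : bimod (ground k) A :=
  @Bimod k (ground k) A F (fun c x => [ffun i => kalg_unit A c * x i])
    (fun x a => [ffun i => x i * a]) _ _ _ _ _ _ _ _ _ _.
Next Obligation. by move=> c x y; apply/ffunP => i; rewrite !ffunE mulrDr. Qed.
Next Obligation. by move=> x c d; apply/ffunP => i; rewrite !ffunE rmorphD mulrDl. Qed.
Next Obligation. by move=> x; apply/ffunP => i; rewrite !ffunE rmorph1 mul1r. Qed.
Next Obligation. by move=> c d x; apply/ffunP => i; rewrite !ffunE rmorphM mulrA. Qed.
Next Obligation. by move=> c x y; apply/ffunP => i; rewrite !ffunE mulrDl. Qed.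
Next Obligation. by move=> x c d; apply/ffunP => i; rewrite !ffunE mulrDr. Qed.
Next Obligation. by move=> x; apply/ffunP => i; rewrite !ffunE mulr1. Qed.
Next Obligation. by move=> c d x; apply/ffunP => i; rewrite !ffunE mulrA. Qed.
Next Obligation. by move=> c x a; apply/ffunP => i; rewrite !ffunE mulrA. Qed.
Next Obligation. by move=> c x; apply/ffunP => i; rewrite !ffunE kalg_central. Qed.
End FreeModule.

Lemma dual_basis_exists :
  fg_right M -> projective_right M -> inhabited (dual_basis M).
Proof.
move=> [n [e eP]] pM.
pose g (x : free_right n) : rightmod M := \sum_i e i <* (x : {ffun _ -> _}) i.
have gl : rlin g.
  split=> [x y|x a]; rewrite /g.
    by rewrite -big_split; apply: eq_bigr => i _; rewrite ffunE ractDr.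
  by rewrite ract_suml; apply: eq_bigr => i _; rewrite ffunE ractM.
have gs : surj g.
  move=> v; have [a ->] := eP v; exists [ffun i => a i].
  by apply: eq_bigr => i _; rewrite ffunE.
have [h [[hD hB] hK]] := pM _ _ g (@id M) gl gs (rlin_id _).
have xl i : rlin (fun m => (h m : {ffun _ -> _}) i : breg A).
  by split=> [x y|x a]; rewrite ?hD ?hB ffunE.
exact: (inhabits (@DualBasis _ _ _ M n e (fun i => mkdual (xl i))
  (fun m => esym (hK m)))).
Qed.

End DualBasisLemma.

Section Galois.
Variables (k : fieldType) (A : kalg k) (C : coring A).

Definition rcomod_iso R R' (M : rcomod R C) (N : rcomod R' C) (f : M -> N) :=
  rcolin f /\ exists g : N -> M, [/\ rcolin g, cancel f g & cancel g f].

Variable M : rcomod (ground k) C.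
Let S := endo M.
Let MS : rcomod S C := endo_rcomod M.

(* Hom^{-C}(M, C) as a right S-module *)
Definition hom_coring : bimod A S := rhom_bimod MS (coring_rcomod C).

(* Hom^{-C}(M, C) (x)_S M -> C, f (x) m |-> f(m) *)
Definition galois_map : rtens hom_coring MS -> coring_rcomod C :=
  tlift (fun (f : hom_coring) (m : MS) =>
    (f : rhom MS (coring_rcomod C)) m : coring_rcomod C).

Definition galois : Prop :=
  [/\ fg_right M, projective_right M & rcomod_iso galois_map].

Lemma galois_mapE (f : hom_coring) (m : MS) :
  galois_map (f *t m) = (f : rhom MS (coring_rcomod C)) m.
Proof.
rewrite /galois_map tliftE //; split=> [g h x|g x y|g r x] //.
exact: rhomD.
Qed.

(* M^* is taken with respect to any dual basis; there is one. *)
Lemma galois_dual_basis : galois -> inhabited (dual_basis MS).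
Proof.
case=> fgM pM _; exact: (@dual_basis_exists k S A MS).
Qed.

(* S (x)_k M as a left S-module right C-comodule, and its action map *)
Definition endo_tens : rcomod S C := rtens (leftmod (breg S)) M.

Definition endo_act : endo_tens -> MS :=
  tlift (fun (s : leftmod (breg S)) (m : M) => (s : endo_type M) m : MS).

Lemma endo_actE (s : leftmod (breg S)) (m : M) :
  endo_act (s *t m) = (s : endo_type M) m.
Proof.
rewrite /endo_act tliftE //; split=> [g h x|g x y|g c x] //.
exact: (rhomD (g : endo_type M)).
Qed.

(* M^* as a right S-module left C-comodule, M^* (x)_k S, and its action map *)
Variable b : dual_basis MS.

Definition dual_endo : lcomod C S := dual_lcomod b.

Definition dual_tens : lcomod C S := ltens (lforget dual_endo) (rightmod (breg S)).

Definition dual_act : dual_tens -> dual_endo :=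
  tlift (fun (xi : lforget dual_endo) (s : rightmod (breg S)) =>
    (xi : dual_endo) <* (s : S)).

Lemma dual_actE (xi : lforget dual_endo) (s : rightmod (breg S)) :
  dual_act (xi *t s) = (xi : dual_endo) <* (s : S).
Proof.
rewrite /dual_act tliftE //; split=> [x y r|x r r'|x c r].
- exact: (@ractDl _ _ _ dual_endo).
- exact: (@ractDr _ _ _ dual_endo).
- exact/esym/(@ractM _ _ _ dual_endo).
Qed.

End Galois.

(* Main.v *)
From HB Require Import structures.
From mathcomp Require Import all_boot all_algebra.
From mathcomp Require Import boolp classical_sets.
Require Import Defs.

(** Write S for End(M) and let N be a left comodule and right S-module, such as
the dual of M, with a colinear S-linear section sigma of the action
N (x)_k S -> N.  Fix V, finitely generated projective over A, and let H be the
right S-module of colinear maps V -> N.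

Over the field k nothing is lost by tensoring: since V is finitely generated,
a colinear map V -> N (x)_k Y only involves finitely many vectors of Y, and
cutting it into slices along functionals on Y shows that H (x)_k Y is the space
of all colinear maps V -> N (x)_k Y ([ev_tensk_inj], [ev_tensk_surj]).  With
Y = S, composition with sigma becomes a section tau of the action
H (x)_k S -> H ([hom_split]): the hypothesis on N passes to H.

Once H is finitely generated, tau makes it projective.  Indeed tau sends the
generators into F (x)_k S for a finite-dimensional F inside H, so H is a direct
summand of a free module of finite rank ([split_fg_projective]).

For finite generation, let X be a left S-module with N (x)_S X = C.  Splitting
by sigma and by tau, the map from H (x)_S X to the colinear maps V -> N (x)_S X
is a retract of the bijection above for Y = X, hence bijective ([ev_tens_inj],
[ev_tens_surj]).  But colinear maps V -> C are the same as A-linear maps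
V -> A, so H (x)_S X is the dual of V, which is finitely generated over A.
Only finitely many elements of H occur in a finite generating set; if X is
faithfully flat they generate H ([fg_descent]).  Together this is
[lhom_fg_projective].

For a Galois comodule M the map xi (x) m |-> xi(m_0) m_1 identifies
M^* (x)_S M with C, on both sides colinearly ([comatrix_bij],
[comatrix_lcolin], [op_comatrix_lcolin]).  This gives the first half, with
X = M.  The second half is the first one over the opposite coring, where M
becomes a left comodule and its dual takes the part of X. *)

Set Implicit Arguments.
Unset Strict Implicit.
Unset Printing Implicit Defensive.

Import GRing.Theory.
Local Open Scope ring_scope.

#[local] Obligation Tactic := idtac.

(** * Finite sums and retracts *)

Lemma tensor_sum (k : fieldType) (A B D : kalg k) (X : bimod A B) (Y : bimod B D)
    (t : tensor X Y) :
  exists r : seq (X * Y), t = \sum_(p <- r) p.1 *t p.2.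
Proof. by exists (repr (t : tens _ _)); rewrite -{1}[t]tlift_pure. Qed.

Lemma llin_sum (k : fieldType) (A B B' : kalg k) (X : bimod A B) (Y : bimod A B')
    (f : X -> Y) I (r : seq I) (F : I -> X) :
  llin f -> f (\sum_(i <- r) F i) = \sum_(i <- r) f (F i).
Proof. by move=> fl; apply: addm_sum; case: fl. Qed.

Lemma rlin_sum (k : fieldType) (A A' B : kalg k) (X : bimod A B) (Y : bimod A' B)
    (f : X -> Y) I (r : seq I) (F : I -> X) :
  rlin f -> f (\sum_(i <- r) F i) = \sum_(i <- r) f (F i).
Proof. by move=> fl; apply: addm_sum; case: fl. Qed.

Section LeftRetract.
Variables (k : fieldType) (A B B' : kalg k) (X : bimod A B) (Y : bimod A B').
Variables (p : X -> Y) (q : Y -> X).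
Hypotheses (pl : llin p) (ql : llin q) (pK : cancel p q).

Lemma retract_fg_left : fg_left Y -> fg_left X.
Proof.
move=> [n [y yP]]; exists n, (q \o y) => x; have [a xE] := yP (p x).
exists a; rewrite -[x in LHS]pK xE (llin_sum _ _ ql).
by apply: eq_bigr => i _; exact: ql.2.
Qed.

Lemma retract_projective_left : projective_left Y -> projective_left X.
Proof.
move=> pY U W g f gl gs fl.
have [h [hl hE]] := pY U W g (fun y => f (q y)) gl gs (llin_comp fl ql).
exists (fun x => h (p x)); split; first exact: llin_comp hl pl.
by move=> x; rewrite hE pK.
Qed.
End LeftRetract.

(** * Finite-dimensional parts of a vector space *)

Section Functionals.
Variables (k : fieldType) (D : kalg k) (Y : bimod (ground k) D).
Implicit Types (c : ground k) (y : Y).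

Definition functional (l : Y -> breg (ground k)) := llin l.

Lemma lactN c y : c *> (- y) = - (c *> y).
Proof. exact: (addm_opp (@lactDr _ _ _ Y c)). Qed.

Lemma lact0l y : (0 : ground k) *> y = 0.
Proof. exact: (addm0 (@lactDl _ _ _ Y y)). Qed.

Lemma lactNl c y : (- c : ground k) *> y = - (c *> y).
Proof. exact: (addm_opp (@lactDl _ _ _ Y y)). Qed.

Lemma ground_inv c : c <> 0 -> exists d : ground k, d * c = 1.
Proof. by move=> c0; exists ((c : k)^-1)%R; apply: mulVf; exact/eqP. Qed.

(** A subspace maximal among those avoiding y is a hyperplane, and the
    functional is the coefficient of y along it. *)
Lemma exists_functional y : y <> 0 -> exists l, functional l /\ l y = 1.
Proof.
move=> y0.
pose lin (X : set Y) := (forall a b, X a -> X b -> X (a + b)) /\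
  forall c a, X a -> X (c *> a).
pose P (X : set Y) := lin X /\ ~ X y.
have [|X [[[XD XZ] Xy] Xmax]] := @Zorn_bigcup Y P.
  move=> F FP Ftot; split; last by move=> [X FX]; case: (FP X FX).
  split=> [a b [X FX Xa] [X' FX' Xb]|c a [X FX Xa]].
    have [XX'|X'X] := Ftot X X' FX FX'.
      by exists X' => //; apply: (FP X' FX').1.1 => //; exact: XX'.
    by exists X => //; apply: (FP X FX).1.1 => //; exact: X'X.
  by exists X => //; apply: (FP X FX).1.2.
(* The union of the empty chain is empty, so X need not contain 0. *)
pose X0 a := a = 0 \/ X a.
have X0D a b : X0 a -> X0 b -> X0 (a + b).
  move=> [->|Xa] [->|Xb]; rewrite ?addr0 ?add0r; [by left|by right|by right|].
  by right; exact: XD.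
have X0Z c a : X0 a -> X0 (c *> a).
  by move=> [->|Xa]; [left; rewrite lact0 | right; exact: XZ].
have X0N a : X0 a -> X0 (- a).
  by move=> /(X0Z (-1)); rewrite lactNl lact1.
have X0y : ~ X0 y by case=> [/y0|/Xy].
have dec x : exists c, X0 (x - c *> y).
  have [Xx|Xx] := pselect (X0 x); first by exists 0; rewrite lact0l subr0.
  pose B : set Y := fun z => exists a c, X0 a /\ z = a + c *> x.
  have XB : (X `<` B)%classic.
    split=> [a Xa|BX].
      by exists a, 0; rewrite lact0l addr0; split=> //; right.
    apply: Xx; right; apply: BX; exists 0, 1; rewrite lact1 add0r.
    by split=> //; left.
  have : B y.
    apply: contrapT => By; apply: (Xmax B XB); split=> //; split.
      move=> _ _ [a [c [Xa ->]]] [a' [c' [Xa' ->]]].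
      by exists (a + a'), (c + c'); rewrite lactDl addrACA; split=> //; exact: X0D.
    move=> c _ [a [c' [Xa ->]]]; exists (c *> a), (c * c').
    by rewrite lactDr lactM; split=> //; exact: X0Z.
  move=> [a [c [Xa ye]]].
  have c0 : c <> 0 by move=> c0; apply: X0y; rewrite ye c0 lact0l addr0.
  have [d dc] := ground_inv c0; exists d.
  have -> : x - d *> y = - (d *> a).
    by rewrite [in LHS]ye lactDr -lactM dc lact1 opprD addrCA subrr addr0.
  exact/X0N/X0Z.
have uniq x c c' : X0 (x - c *> y) -> X0 (x - c' *> y) -> c = c'.
  move=> Xc Xc'; apply: contrapT => cc'; apply: X0y.
  have d0 : c' - c <> 0 by move=> /subr0_eq /esym.
  have [d dc] := ground_inv d0.
  have := X0D _ _ Xc (X0N _ Xc'); rewrite opprB addrC addrA subrK.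
  rewrite -lactNl -lactDl => /(X0Z d).
  by rewrite -lactM dc lact1.
have [l lP] := choice dec.
exists l; split; last first.
  by apply: (uniq y) (lP y) _; rewrite lact1 subrr; left.
split=> [x x'|c x].
  apply: (uniq (x + x')) (lP _) _.
  by rewrite lactDl opprD addrACA; exact: X0D.
apply: (uniq (c *> x)) (lP _) _.
by rewrite /= lactM -lactN -lactDr; exact: X0Z.
Qed.

(** A finite family is fixed by a finite-rank projection sum_p l_p y_p, built one
    vector at a time: a new vector y contributes y - proj y, paired with a
    functional that kills the range of the previous projection proj. *)
Lemma finite_dual (ys : seq Y) :
  exists s : seq ({l | functional l} * Y),
    forall y, y \in ys -> y = \sum_(p <- s) sval p.1 y *> p.2.
Proof.
elim: ys => [|y ys [s sP]]; first by exists [::].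
pose proj x := \sum_(p <- s) sval p.1 x *> p.2.
have projl : llin proj.
  split=> [x x'|c x].
    rewrite -big_split; apply: eq_bigr => p _ /=.
    by rewrite (svalP p.1).1 lactDl.
  rewrite [RHS]lact_sumr; apply: eq_bigr => p _.
  by rewrite (svalP p.1).2 -lactM.
have [e|/eqP] := eqVneq (y - proj y) 0.
  exists s => z; rewrite inE => /orP [/eqP ->|/sP //].
  by apply/eqP; rewrite -subr_eq0; apply/eqP.
move=> /exists_functional [l [ll l1]].
have ml : functional (fun x => l (x - proj x)).
  split=> [x x'|c x].
    by rewrite -ll.1 projl.1 opprD addrACA.
  by rewrite projl.2 -lactN -lactDr ll.2.
exists ((exist _ _ ml, y - proj y) :: s) => z.
rewrite inE big_cons /= -/(proj z) => /orP [/eqP ->|/sP e].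
  by rewrite l1 lact1 subrK.
by rewrite -[proj z]e subrr (addm0 ll.1) lact0l add0r.
Qed.

End Functionals.

Section Slices.
Variables (k : fieldType) (B D : kalg k).
Variables (N : bimod B (ground k)) (Y : bimod (ground k) D).

(** id (x) l, with N (x)_k k identified with N. *)
Definition slice (l : Y -> breg (ground k)) (t : tensor N Y) : N :=
  tlift (fun x y => x <* l y) t.

Lemma slice_llin l : functional l -> llin (slice l).
Proof.
move=> ll; have lb := ract_balanced N ll.
split; first exact: tliftD.
move=> a t; rewrite /slice tlift_lact // tlift_comp; last exact: lactDr.
by apply: eq_tlift => x y; rewrite lractA.
Qed.

Lemma slice_pure l x y : functional l -> slice l (x *t y) = x <* l y.
Proof. by move=> ll; rewrite /slice (tliftE (ract_balanced N ll)). Qed.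

(** Finitely many tensors involve finitely many vectors of Y; expanding these
    in a finite dual family recovers each tensor from its slices. *)
Lemma finite_slices (ts : seq (tensor N Y)) :
  exists s : seq ({l | functional l} * Y),
    forall t, t \in ts -> t = \sum_(p <- s) slice (sval p.1) t *t p.2.
Proof.
have [r rP] := choice (@tensor_sum _ _ _ _ N Y).
have [s sP] := finite_dual (flatten [seq [seq q.2 | q <- r t] | t <- ts]).
exists s => t tts.
have tE l : functional l -> slice l t = \sum_(q <- r t) q.1 <* l q.2.
  move=> ll; rewrite {1}(rP t) (llin_sum _ _ (slice_llin ll)).
  by apply: eq_bigr => q _; exact: slice_pure.
under eq_bigr => p _ do rewrite (tE _ (svalP p.1)) tpure_suml.
rewrite exchange_big {1}(rP t) !big_seq; apply: eq_bigr => q qr /=.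
rewrite {1}(sP q.2) ?tpure_sumr; last first.
  by apply/flatten_mapP; exists t => //; exact: map_f.
by apply: eq_bigr => p _; rewrite -tpureB.
Qed.

End Slices.

(** * Modules split off from an induced module *)

Section RelativeSplitting.
Variables (k : fieldType) (B S D : kalg k) (N : bimod B S) (X : bimod S D).

(** An S-linear section of this action exhibits N as a direct summand of a module
    induced from k. *)
Definition rel_act (t : tensor (leftmod N) (rightmod (breg S))) : N :=
  tlift (fun (n : leftmod N) (s : rightmod (breg S)) => (n : N) <* (s : S)) t.

Lemma rel_act_balanced : tbalanced
  (fun (n : leftmod N) (s : rightmod (breg S)) => (n : N) <* (s : S)).
Proof.
split=> [n n' s|n s s'|n c s] /=.
- exact: ractDl.
- exact: ractDr.
- by rewrite -ractM.
Qed.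

Definition act_at (x : X) (t : tensor (leftmod N) (rightmod (breg S))) :
    tensor (leftmod N) (rightmod X) :=
  tmap id (fun s : rightmod (breg S) => (s : S) *> x : rightmod X) t.

Lemma act_at_llin (x : X) :
  llin (fun s : rightmod (breg S) => (s : S) *> x : rightmod X).
Proof. by split=> [s s'|c s] /=; [exact: lactDl | rewrite lactM]. Qed.

Definition proj_tens (t : tensor (leftmod N) (rightmod X)) : tensor N X :=
  tlift (fun (n : leftmod N) (x : rightmod X) => (n : N) *t (x : X)) t.

Lemma proj_tens_balanced : tbalanced
  (fun (n : leftmod N) (x : rightmod X) => (n : N) *t (x : X)).
Proof.
split=> [n n' x|n x x'|n c x] /=.
- exact: tpureDl.
- exact: tpureDr.
- exact: tpureB.
Qed.

Lemma proj_act_at x t : proj_tens (act_at x t) = rel_act t *t x.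
Proof.
move: t; apply: tensor_ext => [t u|t u|n s].
- rewrite /act_at tmapD //; last exact: act_at_llin.
  exact: (tliftD proj_tens_balanced).
- by rewrite /rel_act (tliftD rel_act_balanced) tpureDl.
- rewrite /act_at tmapE //; last exact: act_at_llin.
  rewrite /proj_tens (tliftE proj_tens_balanced).
  by rewrite /rel_act (tliftE rel_act_balanced) tpureB.
Qed.

Variable sigma : N -> tensor (leftmod N) (rightmod (breg S)).
Hypotheses (sigma_rlin : rlin sigma) (sigmaK : forall n, rel_act (sigma n) = n).

(** sigma (x)_S X, with (N (x)_k S) (x)_S X identified with N (x)_k X.  It is a
    section of the projection from N (x)_k X onto N (x)_S X, and this is how
    questions about (x)_S are reduced to questions about (x)_k. *)
Definition split_tens (t : tensor N X) : tensor (leftmod N) (rightmod X) :=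
  tlift (fun n x => act_at x (sigma n)) t.

Lemma split_tens_balanced : tbalanced (fun n x => act_at x (sigma n)).
Proof.
case: sigma_rlin => sD sB; split=> [n n' x|n x x'|n s x].
- by rewrite sD /act_at tmapD //; exact: act_at_llin.
- rewrite -tlift_addf; apply: eq_tlift => m s.
  by rewrite lactDr -tpureDr.
- rewrite sB /act_at /tmap tlift_ract; last first.
    by apply: tmap_balanced => //; exact: act_at_llin.
  by apply: eq_tlift => m r; rewrite /= lactM.
Qed.

Lemma split_tens_pure n x : split_tens (n *t x) = act_at x (sigma n).
Proof. exact: (tliftE split_tens_balanced). Qed.

Lemma split_tensD : {morph split_tens : t u / t + u}.
Proof. exact: (tliftD split_tens_balanced). Qed.

Lemma split_tensK t : proj_tens (split_tens t) = t.
Proof.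
move: t; apply: tensor_ext => [t u|//|n x].
  by rewrite split_tensD; exact: (tliftD proj_tens_balanced).
by rewrite split_tens_pure proj_act_at sigmaK.
Qed.

End RelativeSplitting.

(** * Colinear maps into a tensor product *)

Section Colinear.
Variables (k : fieldType) (A S : kalg k) (C : coring A).
Variables (V : lcomod C (ground k)) (N : lcomod C S).
Let H : bimod (ground k) S := lhom_bimod V N.

(** Evaluation at v.  As v varies, [ev_tens] describes the canonical map from
    H (x)_S X to the maps V -> N (x)_S X, and [ev_tensk] that from H (x)_k Y to
    the maps V -> N (x)_k Y. *)
Definition ev_tens D (X : bimod S D) (v : V) (t : tensor H X) : tensor N X :=
  tmap (fun f : H => (f : lhom V N) v) id t.

Definition ev_tensk D (Y : bimod (ground k) D) (v : V)
    (t : tensor (leftmod H) Y) : tensor (lforget N) Y :=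
  tmap (fun f : leftmod H => (f : lhom V N) v : lforget N) id t.

Lemma ev_rlin v : rlin (fun f : H => (f : lhom V N) v).
Proof. by []. Qed.

Lemma ev_rlink v : rlin (fun f : leftmod H => (f : lhom V N) v : lforget N).
Proof. by []. Qed.

Section Coefficients.
Variables (D : kalg k) (Y : bimod (ground k) D).

Lemma slice_ev l v (t : tensor (leftmod H) Y) : functional l ->
  (slice l t : lhom V N) v = slice (N := lforget N) l (ev_tensk v t).
Proof.
move=> ll; move: t; apply: tensor_ext => [t u|t u|f y].
- by rewrite (slice_llin _ ll).1.
- by rewrite /ev_tensk tmapD // (slice_llin _ ll).1.
- by rewrite /ev_tensk tmapE // !slice_pure.
Qed.

(** Functionals on Y do not touch the coaction, so slicing a colinear map gives
    elements of H; this is what makes [ev_tensk] surjective. *)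
Lemma slice_colin l : functional l ->
  @lcolin _ _ _ _ _ (ltens (lforget N) Y) N (slice (N := lforget N) l).
Proof.
move=> ll; have sl := slice_llin (lforget N) ll.
split; first exact: sl.
apply: tensor_ext => [t u|t u|n y].
- by rewrite sl.1 (lcoact_bilin N).1.1.
- by rewrite (lcoact_bilin (ltens (lforget N) Y)).1.1 tmapD.
- rewrite slice_pure // [lcoact (ltens _ _) _]ltens_coactE tmap_comp //.
  rewrite [LHS](lcolin_ract N (kalg_unit S (l y))).2.
  by apply: eq_tmap => // m; rewrite slice_pure.
Qed.

Lemma ev_tensk_inj (t : tensor (leftmod H) Y) :
  (forall v, ev_tensk v t = 0) -> t = 0.
Proof.
move=> t0; have [s sP] := finite_slices [:: t].
rewrite (sP t) ?mem_head // big1 // => -[[l ll] y] _ /=.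
have -> : slice l t = 0.
  apply: (@lhom_ext _ _ _ _ _ V N) => v.
  by rewrite slice_ev // t0 (addm0 (slice_llin _ ll).1).
exact: (addm0 (tpure_llin (leftmod H) y).1).
Qed.

(** The slices that recover g on finitely many generators of V recover it
    everywhere, by A-linearity. *)
Lemma ev_tensk_surj (g : V -> ltens (lforget N) Y) : fg_left V -> lcolin g ->
  exists t, forall v, ev_tensk v t = g v.
Proof.
move=> [n [x xP]] [gl gc].
have [s sP] := finite_slices (N := lforget N) [seq g (x i) | i <- enum 'I_n].
have gE v : g v = \sum_(p <- s) slice (N := lforget N) (sval p.1) (g v) *t p.2.
  have [a ->] := xP v; rewrite (llin_sum _ _ gl).
  under [RHS]eq_bigr => p _.
    rewrite (llin_sum _ _ (slice_llin (lforget N) (svalP p.1))) tpure_suml.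
    over.
  rewrite exchange_big; apply: eq_bigr => i _ /=.
  rewrite gl.2 {1}(sP (g (x i))); last by rewrite map_f // mem_enum.
  rewrite lact_sumr; apply: eq_bigr => p _.
  by rewrite tpure_lact (slice_llin (lforget N) (svalP p.1)).2.
have cl l : functional l -> lcolin (fun v => slice (N := lforget N) l (g v) : N).
  move=> ll; exact: (lcolin_comp (slice_colin ll) (conj gl gc)).
exists (\sum_(p <- s) (mklhom (cl _ (svalP p.1)) : leftmod H) *t p.2) => v.
rewrite [RHS]gE /ev_tensk (addm_sum _ _ (tmapD (ev_rlink v) (llin_id Y))).
by apply: eq_bigr => p _; rewrite tmapE.
Qed.

End Coefficients.

Lemma ltens_map_colin R D D' (W : lcomod C R) (Y : bimod R D) (Y' : bimod R D')
    (h : Y -> Y') : llin h ->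
  @lcolin _ _ _ _ _ (ltens W Y) (ltens W Y') (tmap id h).
Proof.
move=> hl; have tl : llin (tmap (@id W) h : ltens W Y -> ltens W Y').
  by apply: tmap_llin.
split=> //; apply: tensor_ext => [t u|t u|w y].
- by rewrite tmapD // (lcoact_bilin (ltens W Y')).1.1.
- by rewrite (lcoact_bilin (ltens W Y)).1.1 tmapD.
- rewrite tmapE // [LHS]ltens_coactE [lcoact (ltens W Y) _]ltens_coactE.
  rewrite !tmap_comp //.
  by apply: eq_tmap => // m; rewrite tmapE.
Qed.

Section Split.
Variable sigma : N -> ltens (lforget N) (rightmod (breg S)).
Hypotheses (sigma_rlin : rlin sigma) (sigma_colin : lcolin sigma).
Hypothesis (sigmaK : forall n, rel_act (N := N) (sigma n) = n).
Hypothesis Vfg : fg_left V.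

Lemma split_tens_colin D (X : bimod S D) :
  @lcolin _ _ _ _ _ (ltens N X) (ltens (lforget N) (rightmod X))
    (split_tens (N := N) (X := X) sigma).
Proof.
have [[_ sl] sc] := sigma_colin.
have aD x := (ltens_map_colin (lforget N) (act_at_llin (X := X) x)).
have D' : {morph split_tens (N := N) (X := X) sigma : t u / t + u}.
  exact: split_tensD.
have sL : llin (Y := tensor (lforget N) (rightmod X))
    (split_tens (N := N) (X := X) sigma).
  split=> [//|a]; apply: tensor_ext => [t u|t u|n x].
  - by rewrite lactDr D'.
  - by rewrite D' lactDr.
  - by rewrite tpure_lact !split_tens_pure // sl [LHS](aD x).1.2.
split=> //; apply: tensor_ext => [t u|t u|n x].
- by rewrite D' (lcoact_bilin (ltens (lforget N) (rightmod X))).1.1.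
- by rewrite (lcoact_bilin (ltens N X)).1.1 tmapD.
- rewrite split_tens_pure // [LHS](aD x).2 [lcoact _ (sigma n)]sc.
  rewrite [lcoact (ltens N X) _]ltens_coactE !tmap_comp //; last by case: (aD x).
  by apply: eq_tmap => // m; rewrite split_tens_pure.
Qed.

(** By [ev_tensk_surj] with Y = S, the colinear map sigma o f : V -> N (x)_k S
    comes from a unique tensor, which is tau f; uniqueness makes tau linear. *)
Lemma hom_split : exists tau : H -> tensor (leftmod H) (rightmod (breg S)),
  [/\ rlin tau, forall f, rel_act (tau f) = f
    & forall (f : lhom V N) v, ev_tensk v (tau f) = sigma (f v)].
Proof.
have ex (f : H) : exists t, forall v, ev_tensk v t = sigma ((f : lhom V N) v).
  apply: (ev_tensk_surj (g := fun v => sigma ((f : lhom V N) v))) => //.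
  exact: lcolin_comp sigma_colin (lhomP f).
have [tau tauE] := choice ex.
have uniq (t u : tensor (leftmod H) (rightmod (breg S))) :
    (forall v, ev_tensk v t = ev_tensk v u) -> t = u.
  have eD v := tmapD (ev_rlink v) (llin_id (rightmod (breg S))).
  move=> e; apply/subr0_eq/ev_tensk_inj => v.
  by rewrite /ev_tensk eD (addm_opp (eD v)) -/(ev_tensk v t) e subrr.
exists tau; split=> //.
  split=> [f g|f s]; apply: uniq => v.
    by rewrite {2}/ev_tensk tmapD // -!/(ev_tensk _ _) !tauE lhomDE sigma_rlin.1.
  have er : rlin (ev_tensk (Y := rightmod (breg S)) v) by exact: tmap_rlin.
  by rewrite er.2 !tauE -sigma_rlin.2.
move=> f; apply: (@lhom_ext _ _ _ _ _ V N) => v.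
rewrite -[RHS]sigmaK -tauE; move: (tau f).
have aD := tliftD (rel_act_balanced N); have aD' := tliftD (rel_act_balanced H).
apply: tensor_ext => [t u|t u|h s].
- by rewrite [rel_act _]aD' lhomDE.
- by rewrite /ev_tensk tmapD // [LHS]aD.
- rewrite /ev_tensk tmapE // /rel_act (tliftE (rel_act_balanced N)).
  by rewrite (tliftE (rel_act_balanced H)).
Qed.

Section Retract.
Variables (D : kalg k) (X : bimod S D).

(** [ev_tensk] after [split_tens] tau is [split_tens] sigma after [ev_tens], and
    [split_tens] tau has a retraction; so injectivity passes from [ev_tensk] to
    [ev_tens]. *)
Lemma ev_tens_inj (t : tensor H X) : (forall v, ev_tens v t = 0) -> t = 0.
Proof.
have [tau [tr tK tE]] := hom_split; move=> t0.
rewrite -[t](split_tensK tr tK).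
suff -> : split_tens tau t = 0 by exact: addm0 (tliftD (proj_tens_balanced _ _)).
have sD := split_tensD (X := X) sigma_rlin.
apply: ev_tensk_inj => v; transitivity (split_tens (N := N) sigma (ev_tens v t)).
  move: t {t0}; apply: tensor_ext => [t u|t u|f x].
  - by rewrite split_tensD // /ev_tensk tmapD.
  - by rewrite /ev_tens tmapD // sD.
  - rewrite split_tens_pure // /ev_tens tmapE // split_tens_pure // -tE.
    have al := act_at_llin (X := X) x.
    by rewrite /ev_tensk /act_at !tmap_comp.
by rewrite t0; exact: addm0 sD.
Qed.

(** Lift g to N (x)_k X along sigma, find its preimage in H (x)_k X, and project
    back. *)
Lemma ev_tens_surj (g : V -> ltens N X) : lcolin g ->
  exists t, forall v, ev_tens v t = g v.
Proof.
move=> gc; have [t tE] := ev_tensk_surj Vfg (lcolin_comp (split_tens_colin X) gc).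
exists (proj_tens t) => v.
rewrite -[RHS](split_tensK sigma_rlin sigmaK) -tE; move: t {tE}.
have pN := proj_tens_balanced N X; have pH := proj_tens_balanced H X.
apply: tensor_ext => [t u|t u|f x].
- by rewrite /proj_tens (tliftD pH) /ev_tens tmapD.
- by rewrite /ev_tensk tmapD //; exact: (tliftD pN).
- rewrite /proj_tens (tliftE pH) /ev_tens /ev_tensk !tmapE //.
  by rewrite (tliftE pN).
Qed.

End Retract.
End Split.
End Colinear.

(** * Finite generation and projectivity over S *)

Section FiniteProjective.
Variables (k : fieldType) (S : kalg k) (H : bimod (ground k) S).

Lemma coordinates_projective n (h : 'I_n -> H) (x : 'I_n -> H -> breg S) :
  (forall i, rlin (x i)) -> (forall f, f = \sum_i h i <* x i f) ->
  projective_right H.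
Proof.
move=> xr hx Y Z g f [gD gB] gs [fD fB].
have [y yP] := choice (fun i => gs (f (h i))).
exists (fun z => \sum_i y i <* x i z); split; [split=> [u v|u s]|move=> z].
- rewrite -big_split; apply: eq_bigr => i _.
  by rewrite (xr i).1 ractDr.
- by rewrite ract_suml; apply: eq_bigr => i _; rewrite (xr i).2 ractM.
- rewrite (addm_sum _ _ gD) [in RHS](hx z) (addm_sum _ _ fD).
  by apply: eq_bigr => i _; rewrite gB yP fB.
Qed.

(** The first components of tau on the generators span a finite-dimensional
    subspace of H; applying functionals dual to it to the first factor of tau f
    gives the coordinates of f. *)
Lemma split_fg_projective (tau : H -> tensor (leftmod H) (rightmod (breg S))) :
  rlin tau -> (forall f, rel_act (tau f) = f) -> fg_right H -> projective_right H.
Proof.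
move=> tr tK [n [x xP]].
have [r rP] := choice (@tensor_sum _ _ _ _ (leftmod H) (rightmod (breg S))).
have [s sP] := finite_dual (Y := H)
  (flatten [seq [seq p.1 | p <- r (tau (x j))] | j <- enum 'I_n]).
pose coord (l : H -> breg (ground k)) (t : tensor (leftmod H) (rightmod (breg S))) :=
  tlift (fun (h : leftmod H) (a : rightmod (breg S)) =>
    kalg_unit S (l h) * (a : S)) t.
have cb l : functional l -> tbalanced (fun (h : leftmod H) (a : rightmod (breg S)) =>
    kalg_unit S (l h) * (a : S)).
  move=> ll; split=> [h h' a|h a a'|h c a].
  - by rewrite ll.1 rmorphD mulrDl.
  - by rewrite mulrDr.
  - have -> : h <* c = (c : ground k) *> (h : H) by rewrite -(lractZ c).
    rewrite ll.2 rmorphM /= mulrA; congr (_ * _); exact: kalg_central.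
pose chi (p : {l : H -> breg (ground k) | functional l} * H) f : breg S :=
  coord (sval p.1) (tau f).
have chir p : rlin (chi p).
  have cr := cb _ (svalP p.1); split=> [f g|f a].
    by rewrite /chi /coord tr.1 (tliftD cr).
  rewrite /chi /coord tr.2 (tlift_ract _ _ cr).
  rewrite (@tlift_comp _ _ _ _ _ _ _ _ (fun b => b <* a)); last exact: (ractDl a).
  by apply: eq_tlift => h b /=; rewrite mulrA.
pose F f := \sum_(p <- s) p.2 <* chi p f.
have Fr : rlin F.
  split=> [f g|f a].
    rewrite -big_split; apply: eq_bigr => p _ /=.
    by rewrite (chir p).1 ractDr.
  by rewrite /F ract_suml; apply: eq_bigr => p _; rewrite (chir p).2 ractM.
(* Both sides are S-linear in f, and on generators this is the section
   property of tau with the first components expanded in the dual family. *)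
have FE f : f = F f.
  have [a ->] := xP f; rewrite (rlin_sum _ _ Fr); apply: eq_bigr => j _.
  rewrite Fr.2; congr (_ <* _); rewrite -{1}(tK (x j)) (rP (tau (x j))).
  rewrite [rel_act _](addm_sum _ _ (tliftD (rel_act_balanced H))).
  have chiE p : chi p (x j) =
      \sum_(q <- r (tau (x j))) kalg_unit S (sval p.1 q.1) * (q.2 : S).
    rewrite /chi /coord {1}(rP (tau (x j))).
    rewrite (addm_sum _ _ (tliftD (cb _ (svalP p.1)))).
    by apply: eq_bigr => q _; rewrite (tliftE (cb _ (svalP p.1))).
  rewrite /F; under [RHS]eq_bigr => p _ do rewrite chiE ract_sumr.
  rewrite exchange_big !big_seq; apply: eq_bigr => q qr /=.
  rewrite /rel_act (tliftE (rel_act_balanced H)) {1}(sP q.1); last first.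
    by apply/flatten_mapP; exists j; rewrite ?mem_enum //; exact: map_f.
  rewrite ract_suml; apply: eq_bigr => p _; rewrite ractM; congr (_ <* _).
  exact: lractZ.
pose p i := tnth (in_tuple s) i.
refine (coordinates_projective (n := size s) (h := fun i => (p i).2)
    (x := fun i => chi (p i)) _ _) => [i|f]; first exact: chir.
by rewrite {1}(FE f) /F big_tnth.
Qed.

Lemma tmap0 A (X : bimod S A) (W : bimod (ground k) S) (t : tensor H X) :
  tmap (fun _ => 0 : W) (@id X) t = 0.
Proof.
rewrite /tmap /tlift /tens_lift big1 // => p _.
exact: (addm0 (tpure_llin W p.2).1).
Qed.

(** Write the generators of H (x)_S X as sums of pure tensors h_i (x) x_i and map
    a free module onto the span of the h_i.  This becomes onto after (x)_S X,
    so faithful flatness, applied to the sequence ending in the zero map of H,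
    says that it was onto already. *)
Lemma fg_descent (A : kalg k) (X : bimod S A) :
  faithfully_flat_left X -> fg_right (tensor H X) -> fg_right H.
Proof.
move=> Xff [n [t tP]].
have [r rP] := choice (@tensor_sum _ _ _ _ H X).
pose hs := flatten [seq [seq p.1 | p <- r (t i)] | i <- enum 'I_n].
pose m := size hs; pose h (i : 'I_m) := tnth (in_tuple hs) i.
pose p (x : free_right S m) : H := \sum_i h i <* (x : {ffun _ -> _}) i.
have pr : rlin p.
  split=> [x y|x a]; rewrite /p.
    by rewrite -big_split; apply: eq_bigr => i _; rewrite ffunE ractDr.
  by rewrite ract_suml; apply: eq_bigr => i _; rewrite ffunE ractM.
have p_surj_on q : q \in hs -> exists x, p x = q.
  move=> /(tnthP (in_tuple hs)) [i qE]; pose e : {ffun 'I_m -> S} := [ffun j => (j == i)%:R].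
  exists e; rewrite /p (bigD1 i) //= ffunE eqxx ract1 big1 ?addr0 //.
  move=> j /negbTE ji; rewrite ffunE ji.
  exact: (addm0 (@ractDr _ _ _ H _)).
have zr : rlin (fun _ : H => 0 : H) by exact: rlin0.
have [_ reflect_exact] := Xff _ _ _ p (fun _ : H => 0 : H) pr zr.
have exS : exact_seq p (fun _ : H => 0 : H).
  apply: reflect_exact => w; rewrite tmap0; split=> // _.
  have pXr : rlin (tmap p (@id X)) by exact: tmap_rlin.
  pose im u := exists y, tmap p (@id X) y = u.
  have imD u v : im u -> im v -> im (u + v).
    by move=> [y <-] [y' <-]; exists (y + y'); rewrite pXr.1.
  have im0 : im 0 by exists 0; exact: addm0 pXr.1.
  have imB u a : im u -> im (u <* a) by move=> [y <-]; exists (y <* a); rewrite pXr.2.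
  have [a ->] := tP w; apply: (big_ind im) => // i _; apply: imB; rewrite (rP (t i)).
  rewrite big_seq; apply: (big_ind im) => // q qr.
  have [|x xE] := p_surj_on q.1.
    by apply/flatten_mapP; exists i; rewrite ?mem_enum //; exact: map_f.
  by exists (x *t q.2); rewrite tmapE // xE.
exists m, h => y.
have [x <-] := (exS y).1 erefl.
by exists (x : {ffun _ -> _}).
Qed.

End FiniteProjective.

(** * Opposite algebras, bimodules and corings *)

(** An anti-isomorphism, rather than the opposite ring on its own, so that the
    ground field can stand for its own opposite and passing to the opposite
    twice leads back to the ring one started from. *)
Record anti (k : fieldType) (A A' : kalg k) := Anti {
  anti_fun :> A -> A';
  anti_inv : A' -> A;
  antiK : cancel anti_fun anti_inv;
  anti_invK : cancel anti_inv anti_fun;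
  antiD : {morph anti_fun : a b / a + b};
  anti1 : anti_fun 1 = 1;
  antiM : forall a b, anti_fun (a * b) = anti_fun b * anti_fun a;
  anti_unit : forall c, anti_fun (kalg_unit A c) = kalg_unit A' c
}.

Section Anti.
Variable k : fieldType.

Program Definition anti_sym (A A' : kalg k) (f : anti A A') : anti A' A :=
  @Anti k A' A (anti_inv f) f (@anti_invK _ _ _ f) (@antiK _ _ _ f) _ _ _ _.
Next Obligation.
by move=> A A' f a b; apply: (can_inj (antiK f)); rewrite antiD !anti_invK.
Qed.
Next Obligation. by move=> A A' f; apply: (can_inj (antiK f)); rewrite anti1 anti_invK. Qed.
Next Obligation.
by move=> A A' f a b; apply: (can_inj (antiK f)); rewrite antiM !anti_invK.
Qed.
Next Obligation.
by move=> A A' f c; apply: (can_inj (antiK f)); rewrite anti_unit anti_invK.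
Qed.

Lemma anti_invD (A A' : kalg k) (f : anti A A') : {morph anti_inv f : a b / a + b}.
Proof. exact: (antiD (anti_sym f)). Qed.

Lemma anti_invM (A A' : kalg k) (f : anti A A') a b :
  anti_inv f (a * b) = anti_inv f b * anti_inv f a.
Proof. exact: (antiM (anti_sym f)). Qed.

Definition anti_ground : anti (ground k) (ground k) :=
  @Anti k (ground k) (ground k) id id (fun=> erefl) (fun=> erefl)
    (fun _ _ => erefl) erefl (fun a b => mulrC (a : k) b) (fun=> erefl).

Section Opposite.
Variable A : kalg k.

Definition op_unit (c : k) : A^c := kalg_unit A c.

Fact op_unit_zmod : zmod_morphism op_unit.
Proof. by move=> c d; exact: (rmorphB (kalg_unit A)). Qed.

Fact op_unit_monoid : monoid_morphism op_unit.
Proof.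
split=> [|c d]; first exact: (rmorph1 (kalg_unit A)).
by rewrite mulrC; exact: (rmorphM (kalg_unit A)).
Qed.

HB.instance Definition _ := GRing.isZmodMorphism.Build k A^c op_unit op_unit_zmod.
HB.instance Definition _ := GRing.isMonoidMorphism.Build k A^c op_unit op_unit_monoid.

Definition op_kalg : kalg k :=
  @KAlg k A^c op_unit (fun c a => esym (kalg_central c a)).

Definition anti_op : anti op_kalg A :=
  @Anti k op_kalg A id id (fun=> erefl) (fun=> erefl)
    (fun _ _ => erefl) erefl (fun _ _ => erefl) (fun=> erefl).

End Opposite.
End Anti.

Section Flip.
Variable k : fieldType.
Implicit Types A B D : kalg k.

Program Definition flip A A' B B' (f : anti A A') (g : anti B B')
    (X : bimod A' B') : bimod B A :=
  @Bimod k B A X (fun b x => x <* g b) (fun x a => f a *> x)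
    _ _ _ _ _ _ _ _ _ _.
Next Obligation. by move=> A A' B B' f g X b x y; exact: ractDl. Qed.
Next Obligation. by move=> A A' B B' f g X x b b' /=; rewrite antiD ractDr. Qed.
Next Obligation. by move=> A A' B B' f g X x /=; rewrite anti1 ract1. Qed.
Next Obligation. by move=> A A' B B' f g X b b' x /=; rewrite antiM ractM. Qed.
Next Obligation. by move=> A A' B B' f g X a x y; exact: lactDr. Qed.
Next Obligation. by move=> A A' B B' f g X x a a' /=; rewrite antiD lactDl. Qed.
Next Obligation. by move=> A A' B B' f g X x /=; rewrite anti1 lact1. Qed.
Next Obligation. by move=> A A' B B' f g X a a' x /=; rewrite antiM lactM. Qed.
Next Obligation. by move=> A A' B B' f g X b x a /=; rewrite lractA. Qed.
Next Obligation. by move=> A A' B B' f g X c x /=; rewrite !anti_unit lractZ. Qed.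

Section FlipMaps.
Variables (A A' B B' B1 B1' : kalg k).
Variables (f : anti A A') (g : anti B B') (g1 : anti B1 B1').

Lemma flip_rlin (X : bimod A' B') (Y : bimod A' B1') (h : X -> Y) :
  llin h -> rlin (X := flip f g X) (Y := flip f g1 Y) h.
Proof. by move=> [hD hZ]; split=> // x a; exact: hZ. Qed.

Lemma flip_llin (X : bimod B' A') (Y : bimod B1' A') (h : X -> Y) :
  rlin h -> llin (X := flip g f X) (Y := flip g1 f Y) h.
Proof. by move=> [hD hZ]; split=> // x a; exact: hZ. Qed.
End FlipMaps.

Section FlipModules.
Variables (A A' B B' : kalg k) (f : anti A A') (g : anti B B').
Variable X : bimod A' B'.

Lemma flip_fg_right : fg_left X -> fg_right (flip f g X).
Proof.
move=> [n [x xP]]; exists n, x => y; have [a ->] := xP y.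
by exists (fun i => anti_inv f (a i)); apply: eq_bigr => i _ /=; rewrite anti_invK.
Qed.

Lemma flip_fg_left : fg_right X -> fg_left (flip f g X).
Proof.
move=> [n [x xP]]; exists n, x => y; have [a ->] := xP y.
by exists (fun i => anti_inv g (a i)); apply: eq_bigr => i _ /=; rewrite anti_invK.
Qed.

Lemma flip_projective_right : projective_left X -> projective_right (flip f g X).
Proof.
move=> pX Y Z h p hr hs pr.
pose F := flip (anti_ground k) (anti_sym f).
have pl : llin (X := X) (Y := F Z) p.
  by split=> [|a x]; [exact: pr.1|rewrite -[a in LHS](anti_invK f); exact: pr.2].
have [q [ql qE]] := pX (F Y) (F Z) h p (flip_llin _ _ _ hr) hs pl.
exists q; split=> //; split=> [|x a]; first exact: ql.1.
by rewrite [LHS]ql.2 /= antiK.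
Qed.

Lemma flip_projective_left : projective_right X -> projective_left (flip f g X).
Proof.
move=> pX Y Z h p hr hs pr.
pose F := flip (anti_sym g) (anti_ground k).
have pl : rlin (X := X) (Y := F Z) p.
  by split=> [|x a]; [exact: pr.1|rewrite -[a in LHS](anti_invK g); exact: pr.2].
have [q [ql qE]] := pX (F Y) (F Z) h p (flip_rlin _ _ _ hr) hs pl.
exists q; split=> //; split=> [|a x]; first exact: ql.1.
by rewrite [LHS]ql.2 /= antiK.
Qed.
End FlipModules.

Section Swap.
Variables (A A' B B' D D' : kalg k).
Variables (f : anti A A') (g : anti B B') (h : anti D D').
Variables (X : bimod A' B') (Y : bimod B' D').

(** The flip X (x) Y -> Y^op (x) X^op. *)
Definition swap (t : tensor X Y) : tensor (flip g h Y) (flip f g X) :=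
  tlift (fun (x : X) (y : Y) => (y : flip g h Y) *t (x : flip f g X)) t.

Lemma swap_balanced :
  tbalanced (fun (x : X) (y : Y) => (y : flip g h Y) *t (x : flip f g X)).
Proof.
split=> [x x' y|x y y'|x b y]; [exact: tpureDr|exact: tpureDl|].
have := tpureB (y : flip g h Y) (anti_inv g b) (x : flip f g X).
by rewrite /= anti_invK => ->.
Qed.

Lemma swapE x y : swap (x *t y) = (y : flip g h Y) *t (x : flip f g X).
Proof. exact: (tliftE swap_balanced). Qed.

Lemma swapD : {morph swap : t u / t + u}.
Proof. exact: (tliftD swap_balanced). Qed.

Lemma swap_lact a t : swap (f a *> t) = swap t <* a.
Proof.
move: t; apply: tensor_ext => [t u|t u|x y].
- by rewrite lactDr swapD.
- by rewrite swapD ractDl.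
- by rewrite tpure_lact !swapE tpure_ract.
Qed.

Lemma swap_ract d t : swap (t <* h d) = d *> swap t.
Proof.
move: t; apply: tensor_ext => [t u|t u|x y].
- by rewrite ractDl swapD.
- by rewrite swapD lactDr.
- by rewrite tpure_ract !swapE tpure_lact.
Qed.

Lemma swap_rlin : rlin (swap : flip f h (tensor X Y) -> _).
Proof. by split=> [|t a]; [exact: swapD|exact: swap_lact]. Qed.

Lemma swap_llin : llin (swap : flip f h (tensor X Y) -> _).
Proof. by split=> [|d t]; [exact: swapD|exact: swap_ract]. Qed.

Lemma tlift_swap (G : zmodType) (p : flip g h Y -> flip f g X -> G) t :
  tbalanced p -> tlift p (swap t) = tlift (fun (x : X) (y : Y) => p y x) t.
Proof.
move=> pb; rewrite /swap tlift_comp; last exact: tliftD.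
by apply: eq_tlift => x y; rewrite tliftE.
Qed.

Lemma swap_bij : injective swap /\ surj swap.
Proof.
pose ub (y : flip g h Y) (x : flip f g X) : tensor X Y := (x : X) *t (y : Y).
have ubal : tbalanced ub.
  split=> [y y' x|y x x'|y b x]; [exact: tpureDr|exact: tpureDl|].
  by rewrite /ub /= tpureB.
have K t : tlift ub (swap t) = t.
  move: t; apply: tensor_ext => [t u|//|x y].
    by rewrite swapD (tliftD ubal).
  by rewrite swapE (tliftE ubal).
have K' t : swap (tlift ub t) = t.
  move: t; apply: tensor_ext => [t u|//|x y].
    by rewrite (tliftD ubal) swapD.
  by rewrite (tliftE ubal) swapE.
split=> [t u e|t]; first by rewrite -[t]K e K.
by exists (tlift ub t).
Qed.

End Swap.
Arguments swap {A A' B B' D D'} f g h {X Y} t.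

Lemma swap_tmap A A' B B' D D' A1 A1' D1 D1'
    (f : anti A A') (g : anti B B') (h : anti D D')
    (f1 : anti A1 A1') (h1 : anti D1 D1')
    (X : bimod A' B') (Y : bimod B' D') (X1 : bimod A1' B') (Y1 : bimod B' D1')
    (p : X -> X1) (q : Y -> Y1) t : rlin p -> llin q ->
  swap f1 g h1 (tmap p q t) =
  tmap (q : flip g h Y -> flip g h1 Y1) (p : flip f g X -> flip f1 g X1)
    (swap f g h t).
Proof.
move=> pr ql.
have pl := flip_llin g f f1 pr; have qr := flip_rlin g h h1 ql.
move: t; apply: tensor_ext => [t u|t u|x y].
- by rewrite tmapD // swapD.
- by rewrite swapD tmapD.
- by rewrite tmapE // !swapE tmapE.
Qed.

(** Reversing the order of three factors exchanges the two bracketings; this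
    turns the coassociativity of a right coaction into that of a left one. *)
Lemma swap_assoc A A' B B' D D' E E'
    (f : anti A A') (g : anti B B') (h : anti D D') (e : anti E E')
    (X : bimod A' B') (Y : bimod B' D') (Z : bimod D' E')
    (t : tensor (tensor X Y) Z) :
  tassoc (tmap (swap g h e : flip g e (tensor Y Z) -> _) id
    (swap f g e (tassoc t))) =
  tmap id (swap f g h : flip f h (tensor X Y) -> _) (swap f h e t).
Proof.
have sr := swap_rlin g h e Y Z; have sl := swap_llin f g h X Y.
move: t; apply: tensor_ext3 => [t u|t u|x y z].
- by rewrite tassocD swapD tmapD // tassocD.
- by rewrite swapD tmapD.
- by rewrite tassocE !swapE !tmapE // !swapE tassocE.
Qed.

Lemma exact_seq_transport (U V W U' V' W' : zmodType)
    (p : U -> V) (q : V -> W) (p' : U' -> V') (q' : V' -> W')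
    (u : U -> U') (v : V -> V') (w : W -> W') :
  bijective u -> bijective v -> injective w -> w 0 = 0 ->
  (forall x, v (p x) = p' (u x)) -> (forall y, w (q y) = q' (v y)) ->
  exact_seq p q <-> exact_seq p' q'.
Proof.
move=> [u' uK u'K] [v' vK v'K] wI w0 pE qE; split=> e y.
  rewrite -(v'K y) -qE; split=> [qy|[x xE]].
    have /e [x <-] : q (v' y) = 0 by apply: wI; rewrite w0.
    by exists (u x).
  have -> : q (v' y) = 0; last exact: w0.
  by apply/e; exists (u' x); apply: (can_inj vK); rewrite pE u'K.
split=> [qy|[x <-]].
  have /e [x xE] : q' (v y) = 0 by rewrite -qE qy.
  by exists (u' x); apply: (can_inj vK); rewrite pE u'K.
apply: wI; rewrite qE w0 pE.
by apply/e; exists (u x).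
Qed.

Section FlipFlat.
Variables (A A' B B' : kalg k) (f : anti A A') (g : anti B B') (X : bimod A' B').

Definition unflip (U : bimod (ground k) B) : bimod B' (ground k) :=
  flip (anti_ground k) (anti_sym g) U.

(** Flipping twice gives an action of B equal to that of U only after cancelling
    an anti-isomorphism with its inverse, so [swap] does not land in
    U (x) X^op; this map does. *)
Definition unswap U (t : tensor X (unflip U)) : tensor U (flip f g X) :=
  tlift (fun (x : X) (u : unflip U) => (u : U) *t (x : flip f g X)) t.

Lemma unswap_balanced U :
  tbalanced (fun (x : X) (u : unflip U) => (u : U) *t (x : flip f g X)).
Proof.
split=> [x x' u|x u u'|x b u]; [exact: tpureDr|exact: tpureDl|].
by rewrite /= tpureB /= anti_invK.
Qed.

Lemma unswap_bij U : bijective (@unswap U).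
Proof.
pose ub (u : U) (x : flip f g X) : tensor X (unflip U) := (x : X) *t (u : unflip U).
have ubal : tbalanced ub.
  split=> [u u' x|u x x'|u b x]; [exact: tpureDr|exact: tpureDl|].
  by rewrite /ub /= tpureB /= antiK.
exists (tlift ub).
  apply: tensor_ext => [t u|//|x u].
    by rewrite /unswap (tliftD (@unswap_balanced U)) (tliftD ubal).
  by rewrite /unswap (tliftE (@unswap_balanced U)) (tliftE ubal).
apply: tensor_ext => [t u|//|u x].
  by rewrite (tliftD ubal) /unswap (tliftD (@unswap_balanced U)).
by rewrite (tliftE ubal) /unswap (tliftE (@unswap_balanced U)).
Qed.

Lemma unswap_tmap (U V : bimod (ground k) B) (p : U -> V) t : rlin p ->
  unswap (tmap (@id X) (p : unflip U -> unflip V) t) = tmap p id (unswap t).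
Proof.
move=> pr; have pl := flip_llin (anti_sym g) (anti_ground k) (anti_ground k) pr.
have uD W := tliftD (@unswap_balanced W).
move: t; apply: tensor_ext => [t u|t u|x u].
- by rewrite tmapD // [LHS]uD.
- by rewrite [unswap _]uD tmapD.
- by rewrite tmapE // /unswap !(tliftE (@unswap_balanced _)) tmapE.
Qed.

Lemma faithfully_flat_flip :
  faithfully_flat_right X -> faithfully_flat_left (flip f g X).
Proof.
move=> Xff U V W p q pr qr.
have pl := flip_llin (anti_sym g) (anti_ground k) (anti_ground k) pr.
have ql := flip_llin (anti_sym g) (anti_ground k) (anti_ground k) qr.
apply: (iff_trans (Xff _ _ _ _ _ pl ql)).
apply: (exact_seq_transport (unswap_bij U) (unswap_bij V) (bij_inj (unswap_bij W))).
- exact: addm0 (tliftD (@unswap_balanced W)).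
- by move=> t; exact: unswap_tmap.
- by move=> t; exact: unswap_tmap.
Qed.
End FlipFlat.

Section Opposite.
Variables (A A' : kalg k) (f : anti A A') (C : coring A').

Let op_copr (c : flip f f C) : tensor (flip f f C) (flip f f C) :=
  swap f f f (copr C c).

Lemma swap_coassoc R R' (r : anti R R') (W : rcomod R' C) (w : W) :
  let op_coact (w : flip r f W) : tensor (flip f f C) (flip r f W) :=
    swap r f f (rcoact W w) in
  tassoc (tmap op_copr id (op_coact w)) = tmap id op_coact (op_coact w).
Proof.
move=> op_coact; have [cl cr] := copr_bilin C; have [rl rr] := rcoact_bilin W.
rewrite /op_copr /op_coact.
have sr := swap_rlin f f f C C; have sl := swap_llin r f f W C.
transitivity (tassoc (tmap (swap f f f : flip f f (tensor C C) -> _) (@id (flip r f W))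
    (tmap (copr C : flip f f C -> flip f f (tensor C C)) (@id (flip r f W))
      (swap r f f (rcoact W w))))).
  by rewrite tmap_comp.
rewrite -(@swap_tmap _ _ _ _ _ _ _ _ _ _ r f f r f W C W (tensor C C) id) //.
rewrite -rcoactA swap_assoc.
rewrite (@swap_tmap _ _ _ _ _ _ _ _ _ _ r f f r f W C (tensor W C) C _ id) //.
by rewrite tmap_comp.
Qed.

Let op_counit (c : flip f f C) : breg A := anti_inv f (counit C c).

Fact op_counit_bilin : bilin op_counit.
Proof.
have [[cD cl] [_ cr]] := counit_bilin C.
have D : {morph op_counit : x y / x + y}.
  by move=> x y; rewrite /op_counit cD; exact: anti_invD.
split; split=> //.
  by move=> a x; rewrite /op_counit /= cr /= anti_invM antiK.
by move=> x a; rewrite /op_counit /= cl /= anti_invM antiK.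
Qed.

Fact op_copr_bilin : bilin op_copr.
Proof.
have [[cD cl] [_ cr]] := copr_bilin C.
have D : {morph op_copr : x y / x + y} by move=> x y; rewrite /op_copr cD swapD.
split; split=> //.
  by move=> a x; rewrite /op_copr /= cr swap_ract.
by move=> x a; rewrite /op_copr /= cl swap_lact.
Qed.

Program Definition op_coring : coring A :=
  @Coring k A (flip f f C) op_copr op_counit op_copr_bilin op_counit_bilin _ _ _.
Next Obligation. by move=> c; exact: (@swap_coassoc _ _ f (coring_rcomod C) c). Qed.
Next Obligation.
move=> c; rewrite /op_copr tlift_swap; last first.
  exact: (lact_balanced (flip f f C) op_counit_bilin.2).
rewrite -[RHS](coprKr c); apply: eq_tlift => x y.
by rewrite /op_counit /= anti_invK.
Qed.
Next Obligation.
move=> c; rewrite /op_copr tlift_swap; last first.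
  exact: (ract_balanced (flip f f C) op_counit_bilin.1).
rewrite -[RHS](coprKl c); apply: eq_tlift => x y.
by rewrite /op_counit /= anti_invK.
Qed.

Section OppositeComodule.
Variables (R R' : kalg k) (r : anti R R') (W : rcomod R' C).

Let op_coact (w : flip r f W) : tensor op_coring (flip r f W) :=
  swap r f f (rcoact W w).

Fact op_coact_bilin : bilin op_coact.
Proof.
have [[cD cl] [_ cr]] := rcoact_bilin W.
have D : {morph op_coact : x y / x + y}.
  by move=> x y; rewrite /op_coact cD; exact: swapD.
split; split=> //.
  by move=> a x; rewrite /op_coact /= cr; exact: swap_ract.
by move=> x a; rewrite /op_coact /= cl; exact: swap_lact.
Qed.

Fact op_coactK w :
  tlift (fun c w0 => counit op_coring c *> w0) (op_coact w) = w.
Proof.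
rewrite /op_coact (tlift_swap (X := W) (Y := C) (p := fun c w0 => _ *> w0));
  last first.
  exact: (lact_balanced (flip r f W) op_counit_bilin.2).
rewrite -[RHS](rcoactK w); apply: eq_tlift => x y.
by rewrite /= /op_counit anti_invK.
Qed.

Definition op_rcomod : lcomod op_coring R :=
  @Lcomod k A op_coring R (flip r f W) op_coact op_coact_bilin
    (@swap_coassoc R R' r W) op_coactK.

End OppositeComodule.

Lemma op_colin R R' Q Q' (r : anti R R') (q : anti Q Q')
    (W : rcomod R' C) (U : rcomod Q' C) (g : W -> U) :
  rcolin g <-> lcolin (V := op_rcomod r W) (W := op_rcomod q U) g.
Proof.
have lin : rlin g <-> llin (X := op_rcomod r W) (Y := op_rcomod q U) g.
  split=> [|[gD gl]]; first exact: flip_llin.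
  by split=> // x a; rewrite -(anti_invK f a); exact: gl.
have sE : rlin g -> forall w, swap q f f (tmap g id (rcoact W w)) =
    tmap id (g : op_rcomod r W -> op_rcomod q U) (lcoact (op_rcomod r W) w).
  by move=> gr w; exact: (@swap_tmap _ _ _ _ _ _ _ _ _ _ r f f q f W C U C g id).
split=> -[gl gc]; split=> [|w]; try exact/lin.
  by rewrite -sE // -gc.
have [sI _] := swap_bij q f f U C; apply: sI; rewrite sE; last exact/lin.
exact: gc.
Qed.

End Opposite.
End Flip.

Section LeftDualBasis.
Variables (k : fieldType) (A B : kalg k) (V : bimod A B).

(** The dual basis of V over the opposite of A. *)
Lemma left_dual_basis_exists : fg_left V -> projective_left V ->
  exists n (v : 'I_n -> V) (x : 'I_n -> V -> breg A),
    (forall i, llin (x i)) /\ forall w, w = \sum_i x i w *> v i.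
Proof.
move=> Vfg Vp.
pose f := anti_op A; pose g := anti_op B.
have [b] := @dual_basis_exists k _ _ (flip f g V)
  (flip_fg_right f g Vfg) (@flip_projective_right _ _ _ _ _ f g V Vp).
exists (db_size b), (db_vec b), (fun i w => (db_cov b i : dual_type _) w).
split=> [i|w]; last exact: (dual_basisP b w).
by have [xD xB] := dualP (db_cov b i); split=> // a w; exact: xB.
Qed.

End LeftDualBasis.

(** * Homs into a comodule N with N (x)_S X = C *)

Section ComatrixTheorem.
Variables (k : fieldType) (A S : kalg k) (C : coring A).
Variables (N : lcomod C S) (X : bimod S A) (can : ltens N X -> C).
Hypotheses (can_bilin : bilin can) (can_inj : injective can) (can_surj : surj can).
Hypothesis can_colin : forall t : ltens N X,
  copr C (can t) = tmap id can (lcoact (ltens N X) t).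

(** Lifting a map along an injective colinear map preserves colinearity, because
    the inverse of can may be applied to the second factor of C (x)_A C. *)
Lemma can_inv_colin (V : lcomod C (ground k)) (g : V -> ltens N X) :
  llin (fun v => can (g v)) ->
  (forall v, copr C (can (g v)) = tmap id (fun w => can (g w)) (lcoact V v)) ->
  lcolin g.
Proof.
move=> [gD gl] gc; have [[cD cl] _] := can_bilin.
have gL : llin g by split=> [v w|a v]; apply: can_inj; rewrite ?cD ?cl.
split=> // v; have [can' canK can'K] : bijective can.
  have [h hE] := choice can_surj.
  by exists h => // t; apply: can_inj; rewrite hE.
have c'l : llin can' by split=> [c d|a c]; apply: can_inj; rewrite ?cD ?cl !can'K.
have cL : llin can by case: can_bilin.
have e : tmap id can (lcoact (ltens N X) (g v)) = tmap id can (tmap id g (lcoact V v)).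
  by rewrite -can_colin gc tmap_comp.
have canT (u : tensor C (ltens N X)) : tmap id can' (tmap id can u) = u.
  by rewrite tmap_comp // (eq_tmap _ (fun=> erefl) canK) tmap_id.
by rewrite -[LHS]canT e canT.
Qed.

Variable V : lcomod C (ground k).
Let H : bimod (ground k) S := lhom_bimod V N.

(** The colinear map V -> C whose composite with the counit is x. *)
Definition cofree (x : V -> breg A) (v : V) : C :=
  tlift (fun (c : C) (w : V) => c <* x w) (lcoact V v).

Lemma cofree_colin x : llin x ->
  llin (cofree x) /\ forall v, copr C (cofree x v) = tmap id (cofree x) (lcoact V v).
Proof.
move=> xl; have xb := ract_balanced C xl.
have [cpl cpr] := copr_bilin C.
have contract_l : llin (tlift (fun (c : C) (w : V) => c <* x w)).
  split=> [|a u]; first exact: (tliftD xb).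
  rewrite (tlift_lact _ _ xb) tlift_comp; last exact: lactDr.
  by apply: eq_tlift => d w; rewrite lractA.
split=> [|v]; first exact: (llin_comp contract_l (lcoact_bilin V).1).
pose h (u : tensor C C) (w : V) : tensor C C := u <* x w.
have hb : tbalanced h by exact: (ract_balanced (tensor C C) xl).
transitivity (tlift h (tmap (copr C) id (lcoact V v))).
  rewrite tlift_tmap // /cofree tlift_comp; last exact: cpl.1.
  by apply: eq_tlift => d w; rewrite cpr.2.
transitivity (tmap (@id C) (tlift (fun (c : C) (w : V) => c <* x w))
    (tassoc (tmap (copr C) id (lcoact V v)))); last first.
  by rewrite lcoactA tmap_comp.
move: (tmap (copr C) id (lcoact V v)); apply: tensor_ext3 => [t u|t u|d e w].
- exact: (tliftD hb).
- by rewrite tassocD tmapD.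
- by rewrite (tliftE hb) tassocE tmapE // (tliftE xb) /h tpure_ract.
Qed.

(** Through this pairing with V, H (x)_S X will be the dual of V. *)
Definition pairing (t : tensor H X) (v : V) : breg A :=
  counit C (can (ev_tens v t)).

Lemma pairingD v : {morph pairing^~ v : t u / t + u}.
Proof.
by move=> t u; rewrite /pairing /ev_tens tmapD // can_bilin.1.1 (counit_bilin C).1.1.
Qed.

Lemma pairing_ract t a v : pairing (t <* a) v = pairing t v * a.
Proof.
rewrite /pairing -[RHS](counit_bilin C).2.2 -can_bilin.2.2.
have [_ er] := tmap_rlin (ev_rlin N v) (conj (llin_id X) (rlin_id X)).
by rewrite {1}/ev_tens er.
Qed.

Lemma ev_tens_colin t : @lcolin _ _ _ _ _ V (ltens N X) (fun v => ev_tens v t).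
Proof.
have [r rE] := tensor_sum t.
have pc x : @lcolin _ _ _ _ _ N (ltens N X) (fun n => n *t x).
  by split=> [|n]; [exact: tpure_llin | exact: ltens_coactE].
pose F (p : H * X) : lhom V (ltens N X) :=
  mklhom (lcolin_comp (pc p.2) (lhomP (p.1 : lhom V N))).
have -> : (fun v => ev_tens v t) = (\sum_(p <- r) F p : lhom V (ltens N X)).
  apply/funext => v; rewrite (addm_sum _ _ (fun f g => lhomDE f g v)).
  rewrite rE /ev_tens (addm_sum _ _ (tmapD (ev_rlin N v) (llin_id X))).
  by apply: eq_bigr => p _; rewrite tmapE.
exact: lhomP.
Qed.

(** The counit axiom recovers a colinear map into C from its composite with the
    counit. *)
Lemma pairing_colin_inj (g : V -> ltens N X) : lcolin g ->
  (forall v, counit C (can (g v)) = 0) -> forall v, g v = 0.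
Proof.
move=> [gl gc] g0 v; apply: can_inj.
have cL : llin can by case: can_bilin.
rewrite (addm0 cL.1) -(coprKr (can (g v))) can_colin gc.
rewrite tmap_comp // tlift_tmap; last exact: (ract_balanced C (counit_bilin C).1).
rewrite /tlift /tens_lift big1 // => p _ /=; rewrite g0.
exact: (addm0 (@ractDr _ _ _ C _)).
Qed.

Variable sigma : N -> ltens (lforget N) (rightmod (breg S)).
Hypotheses (sigma_rlin : rlin sigma) (sigma_colin : lcolin sigma).
Hypothesis (sigmaK : forall n, rel_act (N := N) (sigma n) = n).
Hypothesis Vfg : fg_left V.

Lemma pairing_inj t : (forall v, pairing t v = 0) -> t = 0.
Proof.
move=> t0; apply: (ev_tens_inj sigma_rlin sigma_colin sigmaK Vfg).
exact: pairing_colin_inj (ev_tens_colin t) t0.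
Qed.

(** The A-linear form x is the composite with the counit of the colinear map
    [cofree x], which lifts through can and then through [ev_tens_surj]. *)
Lemma pairing_surj (x : V -> breg A) : llin x -> exists t, forall v, pairing t v = x v.
Proof.
move=> xl; have [g' g'E] := choice can_surj.
have [cl cc] := cofree_colin xl.
have gc : lcolin (fun v => g' (cofree x v)).
  apply: can_inv_colin.
    by split=> [v w|a v]; rewrite !g'E ?cl.1 ?cl.2.
  move=> v; rewrite g'E cc; apply: eq_tmap => // w; exact/esym/g'E.
have [t tE] := ev_tens_surj sigma_rlin sigma_colin sigmaK Vfg gc.
exists t => v; rewrite /pairing tE g'E /cofree.
rewrite tlift_comp; last exact: (counit_bilin C).1.1.
rewrite -[in RHS](lcoactK v) tlift_comp; last exact: xl.1.
by apply: eq_tlift => d w; rewrite xl.2 [LHS](counit_bilin C).2.2.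
Qed.

(** The tensors paired with V as a dual basis of V generate H (x)_S X over A,
    which is what [fg_descent] asks for. *)
Theorem lhom_fg_projective : faithfully_flat_left X -> projective_left V ->
  fg_right H /\ projective_right H.
Proof.
move=> Xff Vp.
have Hfg : fg_right H.
  apply: (fg_descent Xff).
  have [n [v [x [xl vx]]]] := left_dual_basis_exists Vfg Vp.
  have [t tE] := choice (fun i => pairing_surj (xl i)).
  exists n, t => u; exists (fun i => pairing u (v i)).
  apply/subr0_eq/pairing_inj => w.
  rewrite (pairingD w) (addm_opp (pairingD w)) (addm_sum _ _ (pairingD w)).
  under eq_bigr => i _ do rewrite pairing_ract tE.
  have pl : llin (pairing u).
    have [ul _] := ev_tens_colin u.
    exact: (llin_comp (counit_bilin C).1 (llin_comp can_bilin.1 ul)).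
  apply/eqP; rewrite subr_eq0; apply/eqP; rewrite [X in pairing u X]vx.
  by rewrite (llin_sum _ _ pl); apply: eq_bigr => i _; exact: pl.2.
split=> //.
have [tau [tr tK _]] := hom_split sigma_rlin sigma_colin sigmaK Vfg.
exact: (split_fg_projective tr tK Hfg).
Qed.

End ComatrixTheorem.

(** * The comatrix isomorphism of a Galois comodule *)

Section Comatrix.
Variables (k : fieldType) (A : kalg k) (C : coring A) (M : rcomod (ground k) C).
Let S := endo M.
Let MS : rcomod S C := endo_rcomod M.
Variable b : dual_basis MS.

Definition comatrix (t : tensor (dual MS) MS) : C :=
  tlift (fun (xi : dual MS) (m : MS) => dual_contract xi m) t.

Lemma comatrix_balanced :
  tbalanced (fun (xi : dual MS) (m : MS) => dual_contract xi m).
Proof.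
split=> [xi zeta m|xi m m'|xi s m].
- exact: dual_contractDl.
- exact: dual_contractD.
- exact: dual_contract_ract.
Qed.

Lemma comatrixE xi m : comatrix (xi *t m) = dual_contract xi m.
Proof. exact: (tliftE comatrix_balanced). Qed.

Lemma comatrixD : {morph comatrix : t u / t + u}.
Proof. exact: (tliftD comatrix_balanced). Qed.

Lemma comatrix_bilin : bilin comatrix.
Proof.
have D := comatrixD; split; split=> //.
  move=> a; apply: tensor_ext => [t u|t u|xi m].
  - by rewrite lactDr D.
  - by rewrite D lactDr.
  - by rewrite tpure_lact !comatrixE dual_contract_lact.
move=> t a; move: t; apply: tensor_ext => [t u|t u|xi m].
- by rewrite ractDl D.
- by rewrite D ractDl.
- by rewrite tpure_ract !comatrixE (dual_contract_rlin xi).2.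
Qed.

(** On xi (x) m both sides are sum_i xi(e^i_0) e^i_1 (x) xi^i(m_0) m_1, once the
    coaction of m is expanded in the dual basis. *)
Lemma comatrix_lcolin (t : ltens (dual_endo b) MS) :
  copr C (comatrix t) = tmap id comatrix (lcoact (ltens (dual_endo b) MS) t).
Proof.
have [cl cr] := copr_bilin C; have [ml mr] := comatrix_bilin.
move: t; apply: tensor_ext => [t u|t u|xi m].
- by rewrite comatrixD cl.1.
- by rewrite (lcoact_bilin (ltens (dual_endo b) MS)).1.1 tmapD.
rewrite [lcoact (ltens _ _) _]ltens_coactE tmap_comp //.
rewrite comatrixE dual_contract_copr (dual_basis_coact b).
rewrite (addm_sum _ _ (tmapD (dual_contract_rlin xi) (llin_id _))).
have ev_l : llin (fun zeta : dual MS => comatrix (zeta *t m)).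
  exact: llin_comp ml (tpure_llin (dual MS) m).
rewrite (addm_sum _ _ (tmapD (rlin_id C) ev_l)); apply: eq_bigr => i _.
rewrite !tmapE ?comatrixE //; exact: dual_contract_rlin.
Qed.

Hypothesis hM : galois M.

(** The counit identifies Hom(M, C) with the dual of M, the inverse being
    xi |-> (m |-> xi(m_0) m_1); under it the comatrix map becomes the evaluation
    map that is invertible for a Galois comodule. *)
Lemma comatrix_bij : injective comatrix /\ surj comatrix.
Proof.
have [_ _ [_ [g [_ gK Kg]]]] := hM.
have [el er] := counit_bilin C.
pose i (f : hom_coring M) : dual MS :=
  mkdual (rlin_comp er (rhomP (f : rhom MS (coring_rcomod C))).1).
have jc (xi : dual MS) :
    @rcolin _ _ _ _ _ MS (coring_rcomod C) (dual_contract xi).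
  by split=> [|m]; [exact: dual_contract_rlin | exact: dual_contract_copr].
pose j (xi : dual MS) : hom_coring M := mkrhom (jc xi).
have ijK : cancel j i.
  move=> xi; apply: dual_ext => m; rewrite /= /dual_contract.
  rewrite tlift_comp; last exact: el.1.
  rewrite -[in RHS](rcoactK m) tlift_comp; last exact: dualD.
  by apply: eq_tlift => m0 c; rewrite dual_ractE el.2.
have contractE f m : dual_contract (i f) m = (f : rhom MS (coring_rcomod C)) m.
  have [fr fc] := rhomP (f : rhom MS (coring_rcomod C)).
  rewrite -[RHS](coprKl) [copr C _]fc tlift_tmap //.
  exact: (lact_balanced C er).
have ir : rlin i.
  by split=> [f h|f s]; apply: dual_ext => m //; exact: el.1.
have jr : rlin j.
  split=> [xi zeta|xi s]; apply: (@rhom_ext _ _ _ _ _ MS (coring_rcomod C)) => m /=.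
    exact: dual_contractDl.
  exact: dual_contract_ract.
have E t : comatrix (tmap i id t) = galois_map t.
  have gb : tbalanced (fun (f : hom_coring M) (m : MS) =>
      (f : rhom MS (coring_rcomod C)) m : coring_rcomod C).
    by split=> [f h x|f x y|f s x] //; exact: rhomD.
  move: t; apply: tensor_ext => [t u|t u|f m].
  - by rewrite tmapD // comatrixD.
  - exact: (tliftD gb).
  - by rewrite tmapE // comatrixE contractE galois_mapE.
split=> [t u|c]; last by exists (tmap i id (g c)); rewrite E Kg.
have K t' : tmap i id (tmap j (@id MS) t') = t'.
  by rewrite tmap_comp // (eq_tmap _ ijK (fun=> erefl)) tmap_id.
by rewrite -{1}[t]K -{1}[u]K !E => /(can_inj gK) e; rewrite -[t]K e K.
Qed.

Section Opposite.
Variables (A1 S1 : kalg k) (f : anti A1 A) (s : anti S1 S).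
Let N := op_rcomod f s MS.
Let X := flip f s (dual MS).

Definition op_comatrix (t : ltens N X) : op_coring f C :=
  tlift (fun (m : N) (xi : X) => dual_contract (xi : dual MS) m : op_coring f C) t.

Lemma op_comatrix_balanced : tbalanced
  (fun (m : N) (xi : X) => dual_contract (xi : dual MS) m : op_coring f C).
Proof.
split=> [m m' xi|m xi zeta|m r xi].
- exact: (@dual_contractD _ _ _ _ MS).
- exact: (@dual_contractDl _ _ _ _ MS).
- exact/esym/(@dual_contract_ract _ _ _ _ MS).
Qed.

Lemma op_comatrix_swap (t : tensor (dual MS) MS) :
  op_comatrix (swap f s f t) = comatrix t.
Proof. by rewrite /op_comatrix tlift_swap //; exact: op_comatrix_balanced. Qed.

Lemma op_comatrix_bij : injective op_comatrix /\ surj op_comatrix.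
Proof.
have [ci cs] := comatrix_bij; have [si ss] := swap_bij f s f (dual MS) MS.
split=> [t u|c].
  have [t' <-] := ss t; have [u' <-] := ss u.
  by rewrite !op_comatrix_swap => /ci ->.
by have [t tE] := cs c; exists (swap f s f t); rewrite op_comatrix_swap.
Qed.

Lemma op_comatrix_bilin : bilin op_comatrix.
Proof.
have D := tliftD op_comatrix_balanced; have [[_ cl] [_ cr]] := comatrix_bilin.
have [_ ss] := swap_bij f s f (dual MS) MS.
split; split=> //.
  move=> a t; have [u <-] := ss t.
  by rewrite -[_ *> _]swap_ract !op_comatrix_swap cr.
move=> t a; have [u <-] := ss t.
by rewrite -[_ <* _]swap_lact !op_comatrix_swap cl.
Qed.

(** Over the opposite coring this is the colinearity of m |-> xi(m_0) m_1 as a map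
    of right comodules. *)
Lemma op_comatrix_lcolin (t : ltens N X) :
  copr (op_coring f C) (op_comatrix t) =
  tmap id op_comatrix (lcoact (ltens N X) t).
Proof.
have [[mD ml] mr] := op_comatrix_bilin; have [[cD cl] cr] := copr_bilin (op_coring f C).
move: t; apply: tensor_ext => [t u|t u|m xi].
- by rewrite mD cD.
- by rewrite (lcoact_bilin (ltens N X)).1.1 tmapD.
rewrite [lcoact (ltens _ _) _]ltens_coactE tmap_comp //.
have E m' : op_comatrix (m' *t xi) = dual_contract (xi : dual MS) m'.
  exact: (tliftE op_comatrix_balanced).
rewrite E (eq_tmap _ (fun=> erefl) E).
rewrite [LHS]/= [copr C _]dual_contract_copr.
have dr := dual_contract_rlin (xi : dual MS).
exact: (@swap_tmap _ _ _ _ _ _ _ _ _ _ _ s f f f f MS C C C _ id).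
Qed.

(** The flip S (x)_k M -> M^op (x)_k S^op, carrying a section of the action on M
    to one of the kind used for left comodules. *)
Definition turn (t : endo_tens M) : ltens (lforget N) (rightmod (breg S1)) :=
  tlift (fun (r : leftmod (breg S)) (m : M) =>
    (m : lforget N) *t (anti_inv s r : rightmod (breg S1))) t.

Lemma turn_balanced : tbalanced (fun (r : leftmod (breg S)) (m : M) =>
  (m : lforget N) *t (anti_inv s r : rightmod (breg S1))).
Proof.
split=> [r r' m|r m m'|r c m].
- by rewrite anti_invD tpureDr.
- by rewrite tpureDl.
- rewrite [anti_inv s _]anti_invM -(anti_unit s) antiK.
  rewrite -[LHS](@tpureB _ _ _ _ (lforget N) (rightmod (breg S1)) m c).
  by congr (_ *t _); rewrite /= anti_unit.
Qed.

Lemma turnE (r : leftmod (breg S)) (m : M) :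
  turn (r *t m) = (m : lforget N) *t (anti_inv s r : rightmod (breg S1)).
Proof. exact: (tliftE turn_balanced). Qed.

Lemma turnD : {morph turn : t u / t + u}.
Proof. exact: (tliftD turn_balanced). Qed.

Lemma turn_lact r t : turn (s r *> t) = turn t <* r.
Proof.
move: t; apply: tensor_ext => [t u|t u|r' m].
- by rewrite lactDr turnD.
- by rewrite turnD ractDl.
- by rewrite tpure_lact !turnE tpure_ract /= anti_invM antiK.
Qed.

Lemma turn_act t : rel_act (N := N) (turn t) = endo_act t.
Proof.
have aD := tliftD (rel_act_balanced N).
have eD : {morph @endo_act _ _ _ M : t u / t + u}.
  apply: tliftD; split=> [g h x|g x y|g c x] //.
  exact: (rhomD (g : endo_type M)).
move: t; apply: tensor_ext => [t u|//|r m].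
  by rewrite turnD [LHS]aD.
rewrite turnE endo_actE /rel_act (tliftE (rel_act_balanced N)) /=.
by rewrite anti_invK.
Qed.

Lemma turn_colin :
  @lcolin _ _ (op_coring f C) _ _ (op_rcomod f s (endo_tens M))
    (ltens (lforget N) (rightmod (breg S1))) turn.
Proof.
set E := op_rcomod f s _; set T := ltens _ _.
have tl : llin (X := E) (Y := T) turn.
  split=> [|a]; first exact: turnD.
  apply: tensor_ext => [t u|t u|r m].
  - by rewrite [_ *> _](@lactDr _ _ _ E) turnD.
  - by rewrite turnD lactDr.
  - by rewrite [_ *> _]tpure_ract !turnE tpure_lact.
split=> //; apply: tensor_ext => [t u|t u|r m].
- by rewrite turnD (lcoact_bilin T).1.1.
- by rewrite (lcoact_bilin E).1.1 tmapD.
rewrite turnE [lcoact T _]ltens_coactE.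
have pr : rlin (X := MS) (fun m : M => (r : leftmod (breg S)) *t m : endo_tens M).
  exact: (@tpure_rlin _ _ _ _ (leftmod (breg S)) M r).
rewrite [lcoact E _](congr1 _ (rtens_coactE r m)).
rewrite (@swap_tmap _ _ _ _ _ _ _ _ _ _ _ s f f s f MS C (endo_tens M) C _ id) //.
rewrite tmap_comp //.
by apply: eq_tmap => // m'; rewrite turnE.
Qed.
End Opposite.
End Comatrix.

(** * Right homs as left homs over the opposite coring *)

Section HomOpposite.
Variables (k : fieldType) (A A1 S S1 R R1 : kalg k) (C : coring A).
Variables (f : anti A1 A) (s : anti S1 S) (r : anti R1 R).
Variables (W : rcomod R C) (M : rcomod S C).
Let K : bimod R1 S1 := lhom_bimod (op_rcomod f r W) (op_rcomod f s M).

Lemma rhom_flip_fg_projective : fg_right K -> projective_right K ->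
  fg_left (rhom_bimod W M) /\ projective_left (rhom_bimod W M).
Proof.
move=> Kfg Kp.
pose F : bimod S R := flip (anti_sym r) (anti_sym s) K.
pose p (g : rhom_bimod W M) : F := mklhom ((op_colin f r s _).1 (rhomP (g : rhom W M))).
pose q (g : F) : rhom_bimod W M :=
  mkrhom ((op_colin f r s _).2 (lhomP (g : lhom (op_rcomod f r W) (op_rcomod f s M)))).
have pl : llin p.
  split=> [g h|a g]; apply: (@lhom_ext _ _ _ _ _ (op_rcomod f r W) (op_rcomod f s M)).
    by [].
  by move=> w /=; rewrite anti_invK.
have ql : llin q.
  split=> [g h|a g]; apply: (@rhom_ext _ _ _ _ _ W M); first by [].
  by move=> w /=; rewrite anti_invK.
have pK : cancel p q by move=> g; apply: (@rhom_ext _ _ _ _ _ W M).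
split.
  exact: (retract_fg_left ql pK (flip_fg_left (anti_sym r) (anti_sym s) Kfg)).
exact: (retract_projective_left pl ql pK
  (@flip_projective_left _ _ _ _ _ (anti_sym r) (anti_sym s) K Kp)).
Qed.
End HomOpposite.

Theorem proposition6p6 (k : fieldType) (A : kalg k) (C : coring A)
    (M : rcomod (ground k) C) (hM : galois M)
    (b : dual_basis (endo_rcomod M)) :
  (faithfully_flat_left (endo_rcomod M) ->
   (exists sigma : dual_endo b -> dual_tens b,
      [/\ rlin sigma, lcolin sigma & forall xi, dual_act (sigma xi) = xi]) ->
   forall V : lcomod C (ground k),
     fg_left V -> projective_left V ->
     fg_right (lhom_bimod V (dual_endo b)) /\
     projective_right (lhom_bimod V (dual_endo b)))
  /\
  (faithfully_flat_right (dual_endo b) ->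
   (exists sigma : endo_rcomod M -> endo_tens M,
      [/\ llin sigma, rcolin sigma & forall m, endo_act (sigma m) = m]) ->
   forall W : rcomod (ground k) C,
     fg_right W -> projective_right W ->
     fg_left (rhom_bimod W (endo_rcomod M)) /\
     projective_left (rhom_bimod W (endo_rcomod M))).
Proof.
split=> [Mff [sigma [sr sc sK]] V Vfg Vp|Dff [sigma [sl sc sK]] W Wfg Wp].
  have [ci cs] := comatrix_bij hM.
  exact: (lhom_fg_projective (N := dual_endo b) (X := endo_rcomod M)
    (comatrix_bilin M) ci cs (comatrix_lcolin (b := b)) sr sc sK Vfg Mff Vp).
pose f := anti_op A; pose s := anti_op (endo M); pose r := anti_ground k.
have [ci cs] := op_comatrix_bij hM f s.
pose N := op_rcomod f s (endo_rcomod M).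
pose tau (m : N) := turn f s (sigma m).
have tr : rlin (X := N) tau.
  split=> [m m'|m a]; first by rewrite /tau sl.1 turnD.
  by rewrite /tau [sigma _]sl.2 turn_lact.
have tc : lcolin (V := N) tau.
  exact: (lcolin_comp (turn_colin f s) ((op_colin f s s sigma).1 sc)).
have tK (n : N) : rel_act (N := N) (tau n) = n by rewrite /tau turn_act sK.
have [Kfg Kp] := lhom_fg_projective (op_comatrix_bilin f s) ci cs
  (op_comatrix_lcolin (f := f) (s := s)) tr tc tK
  (flip_fg_left r f Wfg : fg_left (op_rcomod f r W))
  (faithfully_flat_flip f s Dff)
  (@flip_projective_left _ _ _ _ _ r f W Wp).
exact: (rhom_flip_fg_projective Kfg Kp).
Qed.
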